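(* Let $X$ be a Banach space with a monotone finite dimensional decomposition. Then $\mathrm{FBL}^{(\infty)}[X]$ is lattice isometric to $\mathrm{FBL}^{(\infty)}[c_0]$.
   Context: Banach spaces are real. For a Banach space $E$, $\mathrm{FBL}^{(\infty)}[E]$ is the closed sublattice of $C(B_{E^*})$ (sup norm; $B_{E^*}$ with the weak$^*$ topology) generated by the functions $\delta_x(x^* )=x^*(x)$, $x\in E$. A sequence $(Z_i)_{i\in\mathbb N}$ of nonzero finite dimensional subspaces of a Banach space $Z$ is a finite dimensional decomposition (FDD) if $Z=\overline{\mathrm{span}}[Z_i:i\in\mathbb N]$ and there are projections $P_i$ from $Z$ onto $Z_i$ such that $P_iP_j=0$ for $i\ne j$, $\sup_n\|\overline P_n\|<\infty$ where $\overline P_n=P_1+\dots+P_n$, and $\overline P_nz\to z$ in norm for every $z\in Z$. The FDD is monotone if $\|\overline P_n\|\le1$ for every $n$. Two Banach lattices are lattice isometric if there is a surjective linear isometry between them that is a lattice homomorphism. *)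

(* Defs.v *)
From HB Require Import structures.
From mathcomp Require Import all_boot all_order all_algebra.
From mathcomp Require Import all_classical all_reals all_analysis.

Set Implicit Arguments.
Unset Strict Implicit.
Unset Printing Implicit Defensive.

Import Order.TTheory GRing.Theory Num.Theory.
Import numFieldNormedType.Exports.

Local Open Scope classical_set_scope.
Local Open Scope ring_scope.

(* The supremum is taken in [\bar R]: it is [+oo] when [f] is unbounded on the
   unit ball. *)
Definition opnorm (R : realType) (E F : normedModType R) (f : E -> F) : \bar R :=
  ereal_sup [set `|f x|%:E | x in [set x | `|x| <= 1]].

(* [dual_ball E] is B_{E^*}.  Used as a type, it carries the topology induced by
   [{ptws E -> R}] (pointwise convergence on [E]), which is the weak* topology. *)
Definition dual_ball (R : realType) (E : normedModType R) : set {ptws E -> R} :=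
  [set f : E -> R | scalar f /\ (opnorm f <= 1)%E].
Arguments dual_ball {R} E _ : rename.

Definition supnorm (R : realType) (T : Type) (f : T -> R) : \bar R :=
  ereal_sup [set `|f t|%:E | t in [set: T]].

(* Closed vector sublattices of C(K), as sets of functions on [K]. The topology
   of [{uniform K -> R}] induces the sup norm topology on C(K), and C(K) is
   closed in it. *)
Definition closed_sublattice (R : realType) (K : topologicalType)
    (A : set (K -> R)) : Prop :=
  [/\ A `<=` [set f | continuous f],
      A (fun=> 0),
      forall (a : R) f g, A f -> A g -> A (fun t => a * f t + g t),
      forall f g, A f -> A g -> A (f \max g) /\ A (f \min g)
    & closed (A : set {uniform K -> R})].

Definition delta (R : realType) (E : normedModType R) (x : E)
    (f : dual_ball E) : R := (\val f : E -> R) x.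

Definition FBLinfty (R : realType) (E : completeNormedModType R) :
    set (dual_ball E -> R) :=
  smallest (@closed_sublattice R (dual_ball E)) (range (@delta R E)).
Arguments FBLinfty {R} E _ : rename.

Lemma continuous_closed_sublattice (R : realType) (K : topologicalType) :
  closed_sublattice [set f : K -> R | continuous f].
Proof.
split => //.
- by move=> t; exact: cvg_cst.
- move=> a f g cf cg t; apply: (@cvgD _ _ _ _ _ (fun t => a * f t) g).
    by apply: cvgMl_tmp; exact: cf.
  exact: cg.
- move=> f g cf cg; split=> t.
    by apply: continuous_max; [exact: cf | exact: cg].
  by apply: continuous_min; [exact: cf | exact: cg].
- move=> f clf.
  pose G := within [set h : K -> R | continuous h] (nbhs (f : {uniform K -> R})).
  have PG : ProperFilter G by exact: within_nbhs_proper clf.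
  apply: (@uniform_limit_continuous _ _ G) => //.
    exact: withinT.
  exact: cvg_within.
Qed.

Lemma delta_continuous (R : realType) (E : normedModType R) (x : E) :
  continuous (@delta R E x).
Proof.
move=> f; apply: (@continuous_comp _ {ptws E -> R} _
    (fun f : dual_ball E => \val f) (fun h : {ptws E -> R} => h x)).
  exact: initial_continuous.
exact: (@proj_continuous _ (fun=> R) x).
Qed.

Lemma FBLinfty_closed_sublattice (R : realType) (E : completeNormedModType R) :
  closed_sublattice (FBLinfty E).
Proof.
have CC := @continuous_closed_sublattice R (dual_ball E).
split.
- apply: smallest_sub; first exact: CC.
  by move=> _ [x _ <-]; exact: delta_continuous.
- by move=> A [[]].
- move=> a f g Ff Fg A CA; case: (CA) => -[_ _ lA _ _] _.
  by apply: lA; [exact: Ff | exact: Fg].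
- by move=> f g Ff Fg; split=> A CA; case: (CA) => -[_ _ _ mA _] _;
    have [] := mA _ _ (Ff _ CA) (Fg _ CA).
- by apply: closed_bigI => A [[]].
Qed.

Definition lattice_isometric (R : realType) (S T : Type)
    (A : set (S -> R)) (B : set (T -> R)) : Prop :=
  exists J : (S -> R) -> (T -> R),
    [/\ J @` A = B,
        forall (a : R) f g, A f -> A g ->
          J (fun s => a * f s + g s) = (fun t => a * J f t + J g t),
        forall f g, A f -> A g ->
          J (f \max g) = J f \max J g /\ J (f \min g) = J f \min J g
      & forall f, A f -> supnorm (J f) = supnorm f].

Definition lspan (R : realType) (X : lmodType R) (A : set X) : set X :=
  [set x | exists n (c : 'I_n -> R) (v : 'I_n -> X),
    (forall i, A (v i)) /\ x = \sum_(i < n) c i *: v i].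

Definition findim_subspace (R : realType) (X : lmodType R) (V : set X) : Prop :=
  exists2 F : set X, finite_set F & V = lspan F.

(* Indices start at 0, so [psum P n] is the sum of the first [n.+1] maps. *)
Definition psum (R : realType) (X : lmodType R) (P : nat -> {linear X -> X})
    (n : nat) (x : X) : X := \sum_(i < n.+1) P i x.

Definition fdd (R : realType) (X : normedModType R) (Z : nat -> set X)
    (P : nat -> {linear X -> X}) : Prop :=
  (forall i, findim_subspace (Z i) /\ Z i <> [set 0]) /\
  closure (lspan (\bigcup_i Z i)) = [set: X] /\
  (forall i, range (P i) = Z i /\ (forall x, P i (P i x) = P i x)) /\
  (forall i j, i <> j -> forall x, P i (P j x) = 0) /\
  (ereal_sup (range (fun n => opnorm (psum P n))) < +oo)%E /\
  (forall x, psum P ^~ x @ \oo --> x).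

Definition monotone_fdd (R : realType) (X : normedModType R)
    (Z : nat -> set X) : Prop :=
  exists P : nat -> {linear X -> X},
    fdd Z P /\ forall n, (opnorm (psum P n) <= 1)%E.

Section c0.
Variable R : realType.

Definition c0_pred : {pred nat -> R} := [pred u | `[< u @ \oo --> (0 : R) >]].

Lemma c0_submod_closed : submod_closed c0_pred.
Proof.
split; first by apply/asboolP; exact: cvg_cst.
move=> a u v /asboolP u0 /asboolP v0; apply/asboolP.
rewrite -[0](addr0 0) -{1}(mulr0 a).
apply: (@cvgD _ _ _ _ _ (a *: u) v) => //.
exact: cvgMl_tmp.
Qed.

HB.instance Definition _ :=
  GRing.isSubmodClosed.Build R (nat -> R) c0_pred c0_submod_closed.

Record c0 : predArgType := C0 { c0_val :> nat -> R ; c0P : c0_val \in c0_pred }.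

HB.instance Definition _ := [isSub for c0_val].
HB.instance Definition _ := [Choice of c0 by <:].
HB.instance Definition _ := [SubChoice_isSubLmodule of c0 by <:].

Definition c0_norm (u : c0) : R := sup (range (fun n => `|u n|)).

Lemma c0_cvg (u : c0) : u @ \oo --> (0 : R).
Proof. by case: u => u /= /asboolP. Qed.

Lemma c0_has_ubound (u : c0) : has_ubound (range (fun n => `|u n|)).
Proof.
apply: bounded_fun_has_ubound; apply: cvg_seq_bounded.
by apply/cvg_ex; exists `|0 : R|; apply: cvg_norm; exact: c0_cvg.
Qed.

Lemma le_c0_norm (u : c0) n : `|u n| <= c0_norm u.
Proof. by apply: ub_le_sup; [exact: c0_has_ubound | exists n]. Qed.

Lemma c0_norm_le (u : c0) (M : R) : (forall n, `|u n| <= M) -> c0_norm u <= M.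
Proof.
move=> uM; apply: ge_sup; first by exists `|u 0%N|, 0%N.
by move=> _ [n _ <-]; exact: uM.
Qed.

Lemma c0_normD (u v : c0) : c0_norm (u + v) <= c0_norm u + c0_norm v.
Proof.
apply: c0_norm_le => n.
by rewrite (le_trans (ler_normD (u n) (v n)))// lerD// le_c0_norm.
Qed.

Lemma c0_normZ (a : R) (u : c0) : c0_norm (a *: u) = `|a| * c0_norm u.
Proof.
have leZ (b : R) (v : c0) : c0_norm (b *: v) <= `|b| * c0_norm v.
  apply: c0_norm_le => n.
  rewrite [`|_|](_ : _ = `|b| * `|v n|); last exact: normrM.
  by rewrite ler_wpM2l// le_c0_norm.
have [->|a0] := eqVneq a 0.
  rewrite scale0r normr0 mul0r; apply/le_anti/andP; split.
    by apply: c0_norm_le => n; rewrite [`|_|]normr0.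
  by apply: le_trans (le_c0_norm _ 0%N); exact: normr_ge0.
apply/le_anti; rewrite leZ/= -ler_pdivlMl ?normr_gt0//.
by rewrite -{1}(scalerK a0 u) -normfV leZ.
Qed.

Lemma c0_norm0_eq0 (u : c0) : c0_norm u = 0 -> u = 0.
Proof.
move=> u0; apply/val_inj/funext => n /=; apply/normr0_eq0/le_anti.
by rewrite normr_ge0 andbT -u0 le_c0_norm.
Qed.

HB.instance Definition _ :=
  Lmodule_isNormed.Build R c0 c0_normD c0_normZ c0_norm0_eq0.

Lemma c0_complete (F : set_system c0) : ProperFilter F -> cauchy F -> cvg F.
Proof.
move=> FF /cauchyP Fc.
have leB (u v : c0) n : `|u n - v n| <= `|u - v| by exact: (le_c0_norm (u - v)).
have Fcn n : cvg ((fun u : c0 => u n) @ F).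
  apply: cauchy_cvg; apply: cauchy_exP => e e0.
  have [v Fv] := Fc _ e0; exists (v n).
  change (F [set u : c0 | ball (v n) e (u n)]); apply: filterS Fv => u.
  by rewrite -ball_normE /= => vu; apply: le_lt_trans (leB v u n) vu.
pose l n := lim ((fun u : c0 => u n) @ F).
have Fl e : 0 < e -> \forall u \near F, forall n, `|l n - (u : c0) n| <= e.
  move=> e0; have e20 : 0 < e / 2 by rewrite divr_gt0.
  have [v Fv] := Fc _ e20; near=> u => n.
  have vu : `|v - u| < e / 2.
    by near: u; apply: filterS Fv => w; rewrite -ball_normE.
  have vl : `|l n - v n| <= e / 2.
    apply: (@cvgr_to_le c0 F _ R (fun w : c0 => `|w n - v n|)).
      by apply: cvg_norm; apply: cvgB; [exact: Fcn | exact: cvg_cst].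
    apply: filterS (Fv) => w; rewrite -ball_normE /= distrC => vw.
    exact: le_trans (leB w v n) (ltW vw).
  rewrite (splitr e) -(subrKA (v n)) (le_trans (ler_normD _ _))// lerD//.
  exact: le_trans (leB v u n) (ltW vu).
have l0 : l @ \oo --> (0 : R).
  apply/cvgr0Pnorm_le => e e0; have e20 : 0 < e / 2 by rewrite divr_gt0.
  have [u lu] := filter_ex (Fl _ e20).
  have /cvgr0Pnorm_le/(_ _ e20) := c0_cvg u.
  apply: filterS => n un; rewrite (splitr e) -(subrK (u n) (l n)).
  by rewrite (le_trans (ler_normD _ _))// lerD.
have lc0 : l \in c0_pred by apply/asboolP.
apply/cvg_ex; exists (C0 lc0); apply/cvgrPdist_le => e e0.
by apply: filterS (Fl _ e0) => u lu; exact: c0_norm_le.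
Unshelve. all: by end_near. Qed.

HB.instance Definition _ := Uniform_isComplete.Build c0 c0_complete.
End c0.

(* Main.v *)
(* By the lattice version of the Stone-Weierstrass theorem, FBL^(oo)[E] consists
   of all weak* continuous positively homogeneous functions on B_{E^*}. It thus
   suffices to find a positively homogeneous weak* homeomorphism from B_{X^*}
   onto the unit ball of l_1 = c_0^*.

   Evaluation at the vectors of bases of the Z_i identifies B_{X^*} with the set
   of real sequences x such that N_n(x) <= 1 for all n, where N_n is the norm of
   the functional composed with the n-th partial sum projection. As the
   decomposition is monotone, N_n increases to the norm. Let a_n(x) be the l_1
   norm of the n-th block of x, and
     A_n = exp(sum_(k < n) 2^-(k+1) a_k / (N_k + a_k)) N_n.
   By convexity N_{n+1} is nondecreasing along the rays of the n-th block, hence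
   A_{n+1} increases strictly from A_n to infinity there. Therefore the map psi
   which rescales the n-th block to the l_1 norm A_{n+1} - A_n is a bijection
   of the space of all sequences, as is seen by solving block after block, and
   the l_1 norm of psi(x) is e^{s(x)} ||x||, s(x) being the sum of the whole
   series in the exponential. Since s is constant on open half-lines,
   phi = e^{-s} psi is still bijective, it is positively homogeneous and
   preserves norms. It is weak* continuous because its j-th coordinate, in block
   n, only involves the uniformly convergent tails of s starting at n or n + 1,
   multiplied by N_n or N_{n+1}, which vanish where these tails are
   discontinuous. *)
Require Import Defs.
From HB Require Import structures.
From mathcomp Require Import all_boot all_order all_algebra.
From mathcomp Require Import all_classical all_reals all_analysis.
From mathcomp Require Import ring lra zify.

Set Implicit Arguments.
Unset Strict Implicit.
Unset Printing Implicit Defensive.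

Import Order.TTheory GRing.Theory Num.Theory.
Import numFieldNormedType.Exports.

Local Open Scope classical_set_scope.
Local Open Scope ring_scope.

(** * Continuous positively homogeneous functions on the dual ball *)

Section scalar_fun.
Context {R : realType} {E : lmodType R} (f : E -> R) (lf : scalar f).

Let g : {scalar E} :=
  HB.pack_for {scalar E} f (GRing.isLinear.Build R E R _ f lf).

Lemma scalar_fun0 : f 0 = 0. Proof. exact: (linear0 g). Qed.

Lemma scalar_funD x y : f (x + y) = f x + f y. Proof. exact: (linearD g). Qed.

Lemma scalar_funB x y : f (x - y) = f x - f y. Proof. exact: (linearB g). Qed.

Lemma scalar_funZ a x : f (a *: x) = a * f x. Proof. exact: (linearZ_LR g). Qed.

Lemma scalar_fun_sum I (r : seq I) (P : pred I) (F : I -> E) :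
  f (\sum_(i <- r | P i) F i) = \sum_(i <- r | P i) f (F i).
Proof. exact: (linear_sum g). Qed.

End scalar_fun.

Lemma opnorm_le1 (R : realType) (E F : normedModType R) (f : E -> F) :
  (forall a x, f (a *: x) = a *: f x) -> (opnorm f <= 1)%E ->
  forall x, `|f x| <= `|x|.
Proof.
move=> fZ f1 x; have [->|x0] := eqVneq x 0.
  by have := fZ 0 0; rewrite !scale0r => ->; rewrite !normr0.
have nx : 0 < `|x| by rewrite normr_gt0.
have : (`|f (`|x|^-1 *: x)|%:E <= 1)%E.
  apply: le_trans f1; apply: ereal_sup_ubound; exists (`|x|^-1 *: x) => //=.
  by rewrite normrZ normfV normr_id mulVf// gt_eqF.
by rewrite lee_fin fZ normrZ normfV normr_id ler_pdivrMl// mulr1.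
Qed.

(** * Weak* compactness of the dual ball *)

Section dual_ball.
Context {R : realType}.

Lemma dual_ballP (E : normedModType R) (f : E -> R) :
  dual_ball E f <-> scalar f /\ forall x, `|f x| <= `|x|.
Proof.
split=> [[lf f1]|[lf f1]]; split => //.
  by apply: opnorm_le1 f1 => a x; exact: (scalar_funZ lf).
apply: ge_ereal_sup => _ [x /= x1 <-]; rewrite lee_fin.
exact: le_trans (f1 x) x1.
Qed.

Let closed_comb (T : topologicalType) (u v w : T -> R) a :
  continuous u -> continuous v -> continuous w ->
  closed [set t | u t - (a * v t + w t) = 0].
Proof.
move=> cu cv cw.
apply: (@preimage_closed _ _ (fun t => u t - (a * v t + w t)) [set 0]);
  last exact: closed_eq.
move=> t _; apply: cvgB; first exact: cu.
by apply: cvgD; [apply: cvgMl_tmp; exact: cv|exact: cw].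
Qed.

Let closed_bound (T : topologicalType) (u : T -> R) M :
  continuous u -> closed [set t | `|u t| <= M].
Proof.
move=> cu; apply: (@preimage_closed _ _ (fun t => `|u t|) [set y | y <= M]);
  last exact: closed_le.
by move=> t _; apply: cvg_norm; exact: cu.
Qed.

(** Banach-Alaoglu: linearity and the norm bounds are closed conditions inside a product of compact
    intervals. *)
Lemma dual_ball_compact (E : normedModType R) :
  compact [set: dual_ball E].
Proof.
have C : @compact {ptws E -> R} (dual_ball E).
  apply: (@subclosed_compact {ptws E -> R} _
    [set f : forall x : E, R | forall x, `[- `|x|, `|x|]%classic (f x)]).
  - have -> : dual_ball E =
      (\bigcap_(t in [set: R * E * E])
        [set f : {ptws E -> R} |
          f (t.1.1 *: t.1.2 + t.2) - (t.1.1 * f t.1.2 + f t.2) = 0]) `&`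
      (\bigcap_(x in [set: E]) [set f : {ptws E -> R} | `|f x| <= `|x|]).
      apply/seteqP; split=> f /=.
        move=> /dual_ballP[lf f1]; split=> [t _|x _]/=; last exact: f1.
        by rewrite lf subrr.
      move=> [lf f1]; apply/dual_ballP; split=> [a x y|x]; last exact: f1.
      by apply/eqP; rewrite -subr_eq0; apply/eqP; exact: (lf (a, x, y)).
    have pc x : continuous (fun f : {ptws E -> R} => f x).
      exact: (@proj_continuous _ (fun=> R) x).
    have c1 (t : R * E * E) := @closed_comb _ _ _ _ t.1.1
      (pc (t.1.1 *: t.1.2 + t.2)) (pc t.1.2) (pc t.2).
    have c2 t := @closed_bound _ _ `|t| (pc t).
    by apply: closedI; apply: closed_bigI => t _; [exact: c1|exact: c2].
  - exact: (@tychonoff E (fun=> R) (fun x => `[- `|x|, `|x|]%classic)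
      (fun x => @segment_compact R _ _)).
  - by move=> f /dual_ballP[_ f1] x /=; rewrite in_itv/= -ler_norml.
move=> F FF _.
have FG : (fmap (@set_val _ (dual_ball E)) F) (dual_ball E).
  by apply: nearW => f; exact: set_valP.
have [p [Kp Fp]] := C _ _ FG.
exists (SigSub (mem_set Kp)); split => // A B FA [V [[W oW <-]/= Wp sWB]].
have [||_ [[f Af <-] Wf]] := Fp (set_val @` A) W.
- by rewrite /fmap/=; apply: filterS FA => f Af; exists f.
- exact: open_nbhs_nbhs.
- by exists f; split => //; exact: sWB.
Qed.

Lemma dual_ball_hausdorff (E : normedModType R) :
  hausdorff_space (dual_ball E).
Proof.
move=> f g fg; apply/val_inj.
apply: (@hausdorff_product _ (fun _ : E => R)).
  by move=> _; exact: Rhausdorff.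
move=> A B Af Bg.
have [||h [Ah Bh]] := fg (set_val @^-1` A) (set_val @^-1` B).
- exact: (@initial_continuous _ {ptws E -> R} (@set_val _ (dual_ball E)) f).
- exact: (@initial_continuous _ {ptws E -> R} (@set_val _ (dual_ball E)) g).
- by exists (set_val h).
Qed.

Lemma continuous_to_dual_ball (E : normedModType R) (T : topologicalType)
    (Phi : T -> dual_ball E) :
  (forall x, continuous (fun t => delta x (Phi t))) -> continuous Phi.
Proof.
move=> cP; apply/continuousP => _ [W oW <-].
have /continuousP : continuous (set_val \o Phi : T -> {ptws E -> R}).
  move=> t; apply/pointwise_cvgP => x; exact: cP.
exact.
Qed.

End dual_ball.

(** If [P] failed on the whole space, the complements of the sets satisfying [P] would form a proper
    filter, and the local hypothesis excludes a cluster point of it. *)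
Lemma compact_ind (K : topologicalType) (P : set K -> Prop) :
  compact [set: K] -> P set0 -> (forall U V, U `<=` V -> P V -> P U) ->
  (forall U V, P U -> P V -> P (U `|` V)) ->
  (forall t : K, exists2 U, nbhs t U & P U) -> P setT.
Proof.
move=> cK P0 Psub PU Ploc; apply: contrapT => nPT.
pose F : set_system K := [set U | P (~` U)].
have FF : ProperFilter F.
  apply: Build_ProperFilter_ex.
    move=> U PU'; apply: contrapT => U0; apply: nPT.
    by apply: Psub PU' => t _ Ut; apply: U0; exists t.
  split.
  - by rewrite /F /= setCT.
  - by move=> U V FU FV; rewrite /F /= setCI; exact: PU.
  - by move=> U V UV; apply: Psub; exact: subsetC.
have [t [_ Ft]] := cK F FF (@filterT _ F _).
have [U tU PU'] := Ploc t.
have [|x [xU nxU]] := Ft (~` U) U _ tU; first by rewrite /F /= setCK.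
exact: xU.
Qed.

(** * Lattice Stone-Weierstrass theorem *)

Section lattice_stone_weierstrass.
Context {R : realType} (K : topologicalType) (A : set (K -> R)).
Hypotheses (cK : compact [set: K]) (AA : closed_sublattice A).

Lemma closed_sublattice_approx (f : K -> R) :
  (forall e, 0 < e -> exists2 g, A g & forall t, `|f t - g t| < e) -> A f.
Proof.
case: AA => _ _ _ _ clA fA; apply: clA => B /uniform_nbhs[E [entE EB]].
have [e e0 eE] : exists2 e : R, 0 < e &
    [set xy : R * R | ball xy.1 e xy.2] `<=` E.
  by move: entE; rewrite -entourage_ballE.
have [g Ag fg] := fA _ e0; exists g; split => //; apply: EB => t _.
by apply: eE; rewrite /ball/=; exact: fg.
Qed.

Lemma lattice_stone_weierstrass (f : K -> R) : continuous f ->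
  (forall s t, exists g, [/\ A g, g s = f s & g t = f t]) -> A f.
Proof.
case: (AA) => Acont A0 Alin Alat _ cf fA;
  apply: closed_sublattice_approx => e e0.
(* A finite maximum of interpolants through [s] exceeds [f - e] everywhere and still equals [f] at
   [s]. *)
have step1 s : exists g, [/\ A g, g s = f s & forall t, f t - e < g t].
  pose P U := exists g, [/\ A g, g s = f s & forall t, U t -> f t - e < g t].
  suff [g [Ag gs gU]] : P setT by exists g; split => // t; exact: gU.
  apply: compact_ind => //.
  - by have [g [Ag gs _]] := fA s s; exists g.
  - by move=> U V UV [g [Ag gs gV]]; exists g; split => // t /UV; exact: gV.
  - move=> U V [g [Ag gs gU]] [h [Ah hs hV]]; exists (g \max h); split.
    + by case: (Alat _ _ Ag Ah).
    + by rewrite /= gs hs maxxx.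
    + by move=> t [/gU|/hV] h1; rewrite lt_max h1// orbT.
  - move=> t; have [g [Ag gs gt]] := fA s t.
    exists [set u | f u - g u < e]; last first.
      by exists g; split=> // u /=; rewrite ltrBlDr -ltrBlDl.
    have : (fun u => f u - g u) @ t --> f t - g t.
      by apply: cvgB; [exact: cf|exact: Acont].
    rewrite gt subrr => /(_ [set y | y < e]); apply.
    exact: lt_nbhsl.
(* A finite minimum of the functions from [step1] stays above [f - e] and gets below [f + e]. *)
pose Q U := exists g, [/\ A g, (forall t, f t - e < g t) &
  forall t, U t -> g t < f t + e].
suff [g [Ag gl gu]] : Q setT.
  exists g => // t; rewrite ltr_distl; have := gl t; have := gu t I.
  by rewrite ltrBlDr ltrBlDr => -> ->.
apply: compact_ind => //.
- have [[s _]|K0] := pselect (exists s : K, True).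
    by have [g [Ag _ gl]] := step1 s; exists g.
  by exists (fun=> 0); split => // t; exfalso; apply: K0; exists t.
- by move=> U V UV [g [Ag gs gV]]; exists g; split => // t /UV; exact: gV.
- move=> U V [g [Ag gl gU]] [h [Ah hl hV]]; exists (g \min h); split.
  + by case: (Alat _ _ Ag Ah).
  + by move=> t; rewrite /= lt_min gl hl.
  + by move=> t [/gU|/hV] h1; rewrite gt_min h1// orbT.
- move=> s; have [g [Ag gs gl]] := step1 s.
  exists [set u | g u - f u < e]; last first.
    by exists g; split=> // u /=; rewrite ltrBlDl.
  have : (fun u => g u - f u) @ s --> g s - f s.
    by apply: cvgB; [exact: Acont|exact: cf].
  rewrite gs subrr => /(_ [set y | y < e]); apply.
  exact: lt_nbhsl.
Qed.

End lattice_stone_weierstrass.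

(** * The free lattice as the positively homogeneous continuous functions *)

Section FBL.
Context {R : realType}.

(** The ball carries no scalar multiplication, so proportionality of [s] and [t] is stated through
    evaluations; [a > 1] is allowed. *)
Definition pos_homogeneous (E : normedModType R) (f : dual_ball E -> R) :=
  forall (a : R) s t, 0 <= a -> (forall x, delta x s = a * delta x t) ->
  f s = a * f t.

Lemma delta_scalar (E : normedModType R) (s : dual_ball E) :
  scalar (fun x => delta x s).
Proof. by case: s => s sE; have /set_mem/dual_ballP[ls _] := sE; exact: ls. Qed.

Lemma le_delta (E : normedModType R) (s : dual_ball E) x :
  `|delta x s| <= `|x|.
Proof. by case: s => s sE; have /set_mem/dual_ballP[_ s1] := sE; exact: s1. Qed.

Section deltaD.
Variables (E : normedModType R) (s : dual_ball E).

Lemma deltaD x y : delta (x + y) s = delta x s + delta y s.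
Proof. exact: scalar_funD (delta_scalar s) x y. Qed.

Lemma deltaB x y : delta (x - y) s = delta x s - delta y s.
Proof. exact: scalar_funB (delta_scalar s) x y. Qed.

Lemma deltaZ a x : delta (a *: x) s = a * delta x s.
Proof. exact: scalar_funZ (delta_scalar s) a x. Qed.

Lemma delta_sum I (r : seq I) (P : pred I) (F : I -> E) :
  delta (\sum_(i <- r | P i) F i) s = \sum_(i <- r | P i) delta (F i) s.
Proof. exact: (scalar_fun_sum (delta_scalar s)). Qed.

End deltaD.

(** Subtracting a suitable multiple of a fixed [x0] outside the kernel of [t] moves any vector into
    that kernel. *)
Lemma delta_sub_ker (E : normedModType R) (s t : dual_ball E) :
  (forall x, delta x t = 0 -> delta x s = 0) ->
  exists a, forall x, delta x s = a * delta x t.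
Proof.
move=> kts; have [[x0 tx0]|t0] := pselect (exists x, delta x t != 0);
  last first.
  exists 0 => x; rewrite mul0r; apply: kts.
  by apply: contrapT => /eqP ?; apply: t0; exists x.
exists (delta x0 s / delta x0 t) => x.
have : delta (x - (delta x t / delta x0 t) *: x0) s = 0.
  by apply: kts; rewrite deltaB deltaZ divfK// subrr.
by rewrite deltaB deltaZ => /eqP; rewrite subr_eq0 => /eqP ->; ring.
Qed.

(** By Stone-Weierstrass it suffices to interpolate [f] at two points; homogeneity makes the two
    values compatible when the points lie on one ray. *)
Lemma pos_homogeneous_FBLinfty (E : completeNormedModType R)
    (f : dual_ball E -> R) :
  continuous f -> pos_homogeneous f -> FBLinfty E f.
Proof.
move=> cf hf; have FE := FBLinfty_closed_sublattice E.
apply: (lattice_stone_weierstrass (@dual_ball_compact R E)) => //.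
have [_ A0 Alin Alat _] := FE.
have Adelta x : FBLinfty E (delta x) by move=> B [_]; apply; exists x.
have AZ a g : FBLinfty E g -> FBLinfty E (fun t => a * g t).
  by move=> Ag; have := Alin a _ _ Ag A0; under eq_fun do rewrite addr0.
have AD g h : FBLinfty E g -> FBLinfty E h -> FBLinfty E (fun t => g t + h t).
  by move=> Ag Ah; have := Alin 1 _ _ Ag Ah; under eq_fun do rewrite mul1r.
have dep s t a : (forall x, delta x s = a * delta x t) ->
    exists g, [/\ FBLinfty E g, g s = f s & g t = f t].
  move=> st; have [[x0 tx0]|t0] := pselect (exists x, delta x t != 0);
    last first.
    have z u : (forall x, delta x u = 0) -> f u = 0.
      by move=> u0; rewrite (@hf 0 u u) ?mul0r// => x; rewrite u0 mul0r.
    have t0' x : delta x t = 0.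
      by apply: contrapT => /eqP ?; apply: t0; exists x.
    exists (fun=> 0); split => //; rewrite z// => x.
    by rewrite st t0' mulr0.
  pose x := (delta x0 t)^-1 *: x0.
  have tx : delta x t = 1 by rewrite deltaZ mulVf.
  have sx : delta x s = a by rewrite st tx mulr1.
  have [a0|a0] := leP 0 a.
    exists (fun u => f t * delta x u); split; first exact: AZ.
      by rewrite sx (hf _ _ _ a0 st) mulrC.
    by rewrite tx mulr1.
  (* For [a < 0] the points lie on opposite rays: the maximum with 0 fits the value at [t], the
     minimum with 0 the value at [s]. *)
  exists (fun u =>
    f t * Num.max (delta x u) 0 + f s / a * Num.min (delta x u) 0).
  split.
  - apply: AD; apply: AZ; first by case: (Alat _ _ (Adelta x) A0).
    by case: (Alat _ _ (Adelta x) A0).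
  - rewrite sx (max_idPr (ltW a0)) (min_idPl (ltW a0)) mulr0 add0r divfK//.
    by rewrite lt_eqF.
  - by rewrite tx (max_idPl ler01) (min_idPr ler01) mulr1 mulr0 addr0.
move=> s t.
have [/delta_sub_ker[a st]|/existsNP[x /not_implyP[tx /eqP sx]]] :=
    pselect (forall x, delta x t = 0 -> delta x s = 0); first exact: dep st.
have [/delta_sub_ker[a st]|/existsNP[y /not_implyP[sy /eqP ty]]] :=
    pselect (forall x, delta x s = 0 -> delta x t = 0).
  by have [g [Ag gt gs]] := dep _ _ _ st; exists g.
(* Neither kernel contains the other: [delta x] vanishes only at [t], and [delta y] only at [s], of
   these two points. *)
exists (fun u => f s / delta x s * delta x u + f t / delta y t * delta y u).
split; first by apply: AD; exact: AZ.
- by rewrite sy mulr0 addr0 divfK.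
- by rewrite tx mulr0 add0r divfK.
Qed.

Lemma FBLinfty_pos_homogeneous (E : completeNormedModType R) :
  FBLinfty E `<=` [set f | continuous f /\ pos_homogeneous f].
Proof.
have [_ c0 clin clat ccl] := @continuous_closed_sublattice R (dual_ball E).
apply: smallest_sub; last first.
  by move=> _ [x _ <-]; split; [exact: delta_continuous|move=> a s t _; exact].
split => //.
- by move=> f [].
- by split => // a s t _ _; rewrite mulr0.
- move=> a f g [cf hf] [cg hg]; split; first exact: clin.
  by move=> b s t b0 st; rewrite (hf b s t)// (hg b s t)//; ring.
- move=> f g [cf hf] [cg hg]; have [cM cm] := clat _ _ cf cg.
  split; split => // b s t b0 st /=; rewrite (hf b s t)// (hg b s t)//.
    by rewrite maxr_pMr.
  by rewrite minr_pMr.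
- move=> f clf; split.
    by apply: ccl => B /clf[g [[cg _] Bg]]; exists g.
  move=> a s t a0 st; apply/eqP; rewrite -subr_eq0 -normr_le0.
  apply/ler_addgt0Pl => e e0; rewrite addr0.
  (* The error at [s] plus [a] times the error at [t] has to stay within [e]. *)
  have d0 : 0 < e / (1 + a) by rewrite divr_gt0// ltr_wpDr.
  have [|g [[_ hg] fg]] := clf [set g | forall u, `|f u - g u| < e / (1 + a)].
    apply/uniform_nbhs; exists [set xy : R * R | ball xy.1 (e / (1 + a)) xy.2].
    split; first by rewrite -entourage_ballE; exists (e / (1 + a)).
    by move=> g /= fg u; exact: fg.
  have -> : f s - a * f t = (f s - g s) - a * (f t - g t).
    by rewrite (hg a s t)//; ring.
  rewrite (le_trans (ler_normB _ _))// normrM (ger0_norm a0).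
  have -> : e = e / (1 + a) + a * (e / (1 + a)).
    by rewrite -[X in X + _]mul1r -mulrDl mulrC divfK// gt_eqF// ltr_wpDr.
  by rewrite lerD// ?ler_wpM2l// ltW// fg.
Qed.

Lemma compact_continuous_inv (K L : topologicalType) (f : K -> L) (g : L -> K) :
  compact [set: K] -> hausdorff_space L -> cancel f g -> cancel g f ->
  continuous f -> continuous g.
Proof.
move=> cK hL fK gK cf; apply/continuous_closedP => C clC.
have -> : g @^-1` C = f @` C.
  apply/seteqP; split => [y Cy|_ [x Cx <-]]; first by exists (g y).
  by rewrite /= fK.
apply: compact_closed => //; apply: continuous_compact.
  exact: continuous_subspaceT.
exact: subclosed_compact clC cK _.
Qed.

(** The isometry is composition with the inverse of [f], which is continuous by compactness and
    inherits the homogeneity. *)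
Lemma lattice_isometric_dual_ball (E F : completeNormedModType R)
    (f : dual_ball E -> dual_ball F) :
  continuous f -> bijective f ->
  (forall (a : R) s t, 0 <= a -> (forall x, delta x s = a * delta x t) ->
     forall y, delta y (f s) = a * delta y (f t)) ->
  lattice_isometric (FBLinfty E) (FBLinfty F).
Proof.
move=> cf [g fK gK] hf.
have cg : continuous g.
  exact: (compact_continuous_inv (@dual_ball_compact _ E)
    (@dual_ball_hausdorff _ F) fK gK).
have hg (a : R) s t : 0 <= a -> (forall x, delta x s = a * delta x t) ->
    forall y, delta y (g s) = a * delta y (g t).
  (* For [b <= 1] the multiple of [g v] by [b] is again in the ball, and [f] maps it to [u]. *)
  have hg1 (b : R) u v : 0 <= b <= 1 -> (forall x, delta x u = b * delta x v) ->
      forall y, delta y (g u) = b * delta y (g v).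
    move=> /andP[b0 b1] uv.
    have bgv : dual_ball E (fun y => b * delta y (g v)).
      apply/dual_ballP; split=> [c x y|x].
        by rewrite deltaD deltaZ; ring.
      by rewrite normrM ger0_norm// (le_trans _ (le_delta (g v) x))// ler_piMl.
    pose w : dual_ball E := SigSub (mem_set bgv).
    have -> : u = f w.
      apply/val_inj/funext => x.
      rewrite -[LHS]/(delta x u) -[RHS]/(delta x (f w)).
      by rewrite (@hf b w (g v))// gK.
    by rewrite fK.
  move=> a0 st y; have [a1|a1] := leP a 1; first by rewrite (@hg1 a s t)// a0.
  have aN0 : a != 0 by rewrite gt_eqF// (lt_trans ltr01).
  rewrite (@hg1 a^-1 t s) ?mulVKf// ?mulrA ?divff ?mul1r//.
    by rewrite invr_ge0 a0 invf_le1// ?ltW// (lt_trans ltr01).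
  by move=> x; rewrite st mulKf.
exists (fun h => h \o g); split => //.
- apply/seteqP; split.
    move=> _ [h /FBLinfty_pos_homogeneous[ch hh] <-].
    apply: pos_homogeneous_FBLinfty.
      by move=> s; apply: continuous_comp; [exact: cg|exact: ch].
    by move=> a s t a0 st; apply: hh => // x; exact: hg.
  move=> k /FBLinfty_pos_homogeneous[ck hk]; exists (k \o f).
    apply: pos_homogeneous_FBLinfty.
      by move=> s; apply: continuous_comp; [exact: cf|exact: ck].
    by move=> a s t a0 st; apply: hk => // x; exact: hf.
  by apply/funext => s /=; rewrite gK.
- move=> h _; rewrite /supnorm; congr ereal_sup; apply/seteqP.
  split => _ [t _ <-]; first by exists (g t).
  by exists (f t) => //=; rewrite fK.
Qed.
End FBL.

(** * Bases with blocks *)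

(* [h] may be discontinuous at the zeros of [g]. *)
Lemma bounded_mul_continuous (R : realType) (T : topologicalType)
    (g h : T -> R) M :
  continuous g -> (forall t, `|h t| <= M) ->
  (forall t, g t != 0 -> {for t, continuous h}) ->
  continuous (fun t => h t * g t).
Proof.
move=> cg hM ch t; have [g0|/ch ht] := eqVneq (g t) 0; last first.
  by apply: cvgM; [exact: ht|exact: cg].
have M0 : 0 <= M by exact: le_trans (hM t).
apply/cvgrPdist_le => eps eps0; rewrite g0 mulr0.
have d0 : 0 < eps / (M + 1) by rewrite divr_gt0// ltr_wpDl.
have /cvgrPdist_le/(_ _ d0) := cg t.
apply: filterS => u; rewrite g0 !sub0r !normrN normrM => gu.
apply: (@le_trans _ _ ((M + 1) * (eps / (M + 1)))).
  by rewrite ler_pM// (le_trans (hM u))// lerDl.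
by rewrite mulrC divfK// gt_eqF// ltr_wpDl.
Qed.

Lemma uniform_approx_continuous (R : realType) (T : topologicalType)
    (h : T -> R) :
  (forall eps, 0 < eps -> exists2 g : T -> R, continuous g &
    forall t, `|h t - g t| <= eps) -> continuous h.
Proof.
move=> hg t; apply/cvgrPdist_le => eps eps0.
have e40 : 0 < eps / 4 by rewrite divr_gt0.
have [g cg gP] := hg _ e40.
have /cvgrPdist_le/(_ _ e40) := cg t.
apply: filterS => u; have := gP t; have := gP u; rewrite !ler_distl; lra.
Qed.

Lemma cvg_sumr (R : realType) (V : normedModType R) (I T : Type)
    (F : set_system T) (r : seq I) (P : pred I) (f : I -> T -> V) (l : I -> V) :
  Filter F ->
  (forall i, P i -> f i x @[x --> F] --> l i) ->
  \sum_(i <- r | P i) f i x @[x --> F] --> \sum_(i <- r | P i) l i.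
Proof.
move=> FF fl; elim: r => [|i r ih].
  by rewrite big_nil; under eq_cvg do rewrite big_nil; exact: cvg_cst.
rewrite big_cons; under eq_cvg do rewrite big_cons.
case: ifP => // Pi; apply: cvgD => //; exact: fl.
Qed.

Lemma linear_combination_continuous (R : realType) (T : topologicalType) n
    (f : nat -> T -> R) (c : nat -> R) : (forall j, continuous (f j)) ->
  continuous (fun t => \sum_(0 <= j < n) f j t * c j).
Proof.
by move=> cf t; apply: cvg_sumr => j _; apply: cvgMr_tmp; exact: cf.
Qed.

Section inverse_powers_of_two.
Context {R : realType}.

Lemma exp2N_gt0 n : 0 < 2 ^- n :> R.
Proof. by rewrite invr_gt0 exprn_gt0. Qed.

Lemma exp2NS n : 2 ^- n = 2 ^- n.+1 + 2 ^- n.+1 :> R.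
Proof. by rewrite exprS invfM -mulrDl -[2^-1]mul1r -splitr mul1r. Qed.

Lemma exp2N_le n m : (n <= m)%N -> 2 ^- m <= 2 ^- n :> R.
Proof.
move=> nm; rewrite lef_pV2 ?posrE ?exprn_gt0//.
by rewrite ler_weXn2l// ler1n.
Qed.

Lemma exp2N_small (eps : R) : 0 < eps -> exists m, 2 ^- m <= eps.
Proof.
move=> eps0; exists (Num.bound eps^-1).
rewrite -[leRHS]invrK lef_pV2 ?posrE ?exprn_gt0 ?invr_gt0//.
have ei : 0 <= eps^-1 by rewrite invr_ge0 ltW.
by rewrite (le_trans (ltW (archi_boundP ei)))// -natrX ler_nat ltnW// ltn_expl.
Qed.

End inverse_powers_of_two.

Section block_index.
Context {o : nat -> nat} (o0 : o 0%N = 0%N) (oS : forall n, (o n < o n.+1)%N).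

Lemma offset_mono n m : (n <= m)%N -> (o n <= o m)%N.
Proof.
elim: m => [|m ih]; first by rewrite leqn0 => /eqP ->.
rewrite leq_eqVlt => /predU1P[->//|/ih h]; exact: leq_trans h (ltnW (oS m)).
Qed.

Lemma leq_offset n : (n <= o n)%N.
Proof. by elim: n => // n ih; exact: leq_ltn_trans ih (oS n). Qed.

Lemma ex_block j : exists n, (j < o n.+1)%N.
Proof. by exists j; exact: leq_offset j.+1. Qed.

Definition block_index j := ex_minn (ex_block j).

Lemma block_indexP j : (o (block_index j) <= j < o (block_index j).+1)%N.
Proof.
rewrite /block_index; case: ex_minnP => n jn nmin; rewrite jn andbT leqNgt.
apply/negP => jn'; case: n jn' nmin {jn} => [|n]; first by rewrite o0.
by move=> jn /(_ n jn); rewrite ltnn.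
Qed.

Lemma block_index_lt j n : (j < o n)%N -> (block_index j < n)%N.
Proof.
move=> jn; rewrite ltnNge; apply/negP => /offset_mono nj.
by have := block_indexP j; lia.
Qed.

Lemma block_indexE j n : (o n <= j < o n.+1)%N -> block_index j = n.
Proof.
move=> /andP[nj /block_index_lt jn]; apply/eqP;
  rewrite eqn_leq -ltnS jn/= leqNgt.
apply/negP => /offset_mono; have := block_indexP j; lia.
Qed.

End block_index.

(* [e] is split into consecutive blocks, the [n]-th one being
   [e (o n), ..., e (o n.+1 - 1)], and only the partial sums over whole blocks
   are required to be contractive and to converge. *)
Record block_basis (R : realType) (X : normedModType R) (e : nat -> X)
    (e' : nat -> X -> R) (o : nat -> nat) : Prop := BlockBasis {
  bb_scalar : forall j, scalar (e' j);
  bb_bounded : forall j, exists C, forall z, `|e' j z| <= C * `|z|;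
  bb_dual : forall i j, e' i (e j) = (i == j)%:R;
  bb_contr : forall n z, `|\sum_(0 <= j < o n) e' j z *: e j| <= `|z|;
  bb_cvg : forall z, (\sum_(0 <= j < o n) e' j z *: e j) @[n --> \oo] --> z;
  bb_o0 : o 0%N = 0%N;
  bb_oS : forall n, (o n < o n.+1)%N }.

Arguments bb_cvg {R X e e' o} _ z.

(** * Norms of truncated functionals *)

Section block_norm.
Context {R : realType} {X : normedModType R} {e : nat -> X}
  {e' : nat -> X -> R} {o : nat -> nat} (bb : block_basis e e' o).

Definition bb_proj n z := \sum_(0 <= j < o n) e' j z *: e j.

Definition bb_coef n (x : nat -> R) z := \sum_(0 <= j < o n) x j * e' j z.

Lemma bb_projE i n z : e' i (bb_proj n z) = if (i < o n)%N then e' i z else 0.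
Proof.
rewrite (scalar_fun_sum (bb_scalar bb i)).
under eq_bigr do rewrite (scalar_funZ (bb_scalar bb i)) (bb_dual bb).
case: ifPn => [io|io].
  rewrite (bigD1_seq i) ?mem_index_iota ?iota_uniq//= eqxx mulr1 big1 ?addr0//.
  by move=> j ij; rewrite eq_sym (negbTE ij) mulr0.
rewrite big_nat big1// => j /andP[_ jo].
by rewrite (_ : i == j = false) ?mulr0//; apply: contraNF io => /eqP ->.
Qed.

Lemma bb_coef_scalar n x : scalar (bb_coef n x).
Proof.
move=> a u v; rewrite /bb_coef mulr_sumr -big_split/=; apply: eq_bigr => j _.
by rewrite (bb_scalar bb); ring.
Qed.

Lemma bb_coef_proj n m x z : (n <= m)%N ->
  bb_coef m x (bb_proj n z) = bb_coef n x z.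
Proof.
move=> nm; rewrite /bb_coef (@big_cat_nat _ _ _ (o n))//=;
  last exact: (offset_mono (bb_oS bb)).
rewrite [X in _ + X]big_nat [X in _ + X]big1 ?addr0; last first.
  by move=> j /andP[nj _]; rewrite bb_projE ltnNge nj mulr0.
by apply: eq_big_nat => j /andP[_ jn]; rewrite bb_projE jn.
Qed.

Lemma bb_coef_e n x j : (j < o n)%N -> bb_coef n x (e j) = x j.
Proof.
move=> jn; rewrite /bb_coef (bigD1_seq j) ?mem_index_iota ?iota_uniq//=.
rewrite (bb_dual bb) eqxx mulr1 big1 ?addr0// => i ij.
by rewrite (bb_dual bb) (negbTE ij) mulr0.
Qed.

(* When [x] lists the values of a functional at the vectors [e j], this is the
   norm of its composition with [bb_proj n]. *)
Definition block_norm n x :=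
  sup [set `|bb_coef n x z| | z in [set z | `|z| <= 1]].

Lemma bb_bound : exists c, forall j z, `|z| <= 1 -> `|e' j z| <= c j.
Proof.
have [c cP] := choice (bb_bounded bb); exists (fun j => `|c j|) => j z z1.
by rewrite (le_trans (cP j z))// (le_trans (ler_norm _))// normrM normr_id
  ler_piMr.
Qed.

Lemma block_norm_has_ub n x :
  has_ubound [set `|bb_coef n x z| | z in [set z | `|z| <= 1]].
Proof.
have [c cP] := bb_bound; exists (\sum_(0 <= j < o n) `|x j| * c j).
move=> _ [z /= z1 <-]; rewrite (le_trans (ler_norm_sum _ _ _))//.
by apply: ler_sum => j _; rewrite normrM ler_wpM2l// cP.
Qed.

Lemma block_norm_le n x M :
  (forall z, `|z| <= 1 -> `|bb_coef n x z| <= M) -> block_norm n x <= M.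
Proof.
move=> xM; apply: ge_sup.
  by exists `|bb_coef n x 0|, 0 => //=; rewrite normr0.
by move=> _ [z /= z1 <-]; exact: xM.
Qed.

Lemma le_block_norm n x z : `|bb_coef n x z| <= block_norm n x * `|z|.
Proof.
have [->|z0] := eqVneq z 0.
  by rewrite (scalar_fun0 (bb_coef_scalar n x)) !normr0 mulr0.
have nz : 0 < `|z| by rewrite normr_gt0.
rewrite -ler_pdivrMr// mulrC.
have -> : `|z|^-1 * `|bb_coef n x z| = `|bb_coef n x (`|z|^-1 *: z)|.
  by rewrite (scalar_funZ (bb_coef_scalar n x)) normrM normfV normr_id.
apply: ub_le_sup; first exact: block_norm_has_ub.
exists (`|z|^-1 *: z) => //=.
by rewrite normrZ normfV normr_id mulVf// gt_eqF.
Qed.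

Lemma block_norm_ge0 n x : 0 <= block_norm n x.
Proof.
apply: (@le_trans _ _ `|bb_coef n x 0|) => //.
by apply: ub_le_sup; [exact: block_norm_has_ub|exists 0 => //=; rewrite normr0].
Qed.

Lemma block_norm0 x : block_norm 0 x = 0.
Proof.
apply/le_anti; rewrite block_norm_ge0 andbT; apply: block_norm_le => z _.
by rewrite /bb_coef (bb_o0 bb) big_geq// normr0.
Qed.

Lemma block_norm_congr n x y : (forall j, (j < o n)%N -> x j = y j) ->
  block_norm n x = block_norm n y.
Proof.
move=> xy; congr (sup (_ @` _)); apply/funext => z; congr `|_|.
by apply: eq_big_nat => j /andP[_ /xy ->].
Qed.

(** [bb_proj n] maps the unit ball into itself by [bb_contr], and [bb_coef m x] composed with it is
    [bb_coef n x]. *)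
Lemma block_norm_mono n m x : (n <= m)%N -> block_norm n x <= block_norm m x.
Proof.
move=> nm; apply: block_norm_le => z z1; rewrite -(bb_coef_proj _ _ nm).
rewrite (le_trans (le_block_norm _ _ _))// ler_piMr ?block_norm_ge0//.
exact: le_trans (bb_contr bb n z) z1.
Qed.

Lemma block_normD n x y :
  block_norm n (fun j => x j + y j) <= block_norm n x + block_norm n y.
Proof.
apply: block_norm_le => z z1.
have -> : bb_coef n (fun j => x j + y j) z = bb_coef n x z + bb_coef n y z.
  by rewrite /bb_coef -big_split; apply: eq_bigr => j _; rewrite mulrDl.
rewrite (le_trans (ler_normD _ _))// lerD// (le_trans (le_block_norm _ _ _))//.
  by rewrite ler_piMr ?block_norm_ge0.
by rewrite ler_piMr ?block_norm_ge0.
Qed.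

Lemma block_normZ n a x :
  block_norm n (fun j => a * x j) = `|a| * block_norm n x.
Proof.
have cZ b y z : bb_coef n (fun j => b * y j) z = b * bb_coef n y z.
  by rewrite /bb_coef mulr_sumr; apply: eq_bigr => j _; rewrite mulrA.
have leZ b y : block_norm n (fun j => b * y j) <= `|b| * block_norm n y.
  apply: block_norm_le => z z1; rewrite cZ normrM ler_wpM2l//.
  by rewrite (le_trans (le_block_norm _ _ _))// ler_piMr ?block_norm_ge0.
have [->|a0] := eqVneq a 0.
  rewrite normr0 mul0r; apply/le_anti; rewrite block_norm_ge0 andbT.
  by rewrite (le_trans (leZ _ _))// normr0 mul0r.
apply/le_anti; rewrite leZ/= -ler_pdivlMl ?normr_gt0// -normfV.
rewrite (le_trans _ (leZ _ _))//.
rewrite (@block_norm_congr _ _ (fun j => a^-1 * (a * x j)))// => j _.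
by rewrite mulKf.
Qed.

Lemma le_coord_block_norm n j x : (j < o n)%N ->
  `|x j| <= block_norm n x * `|e j|.
Proof. by move=> jn; rewrite -{1}(bb_coef_e x jn) le_block_norm. Qed.

Lemma block_norm_eq0 n x : block_norm n x = 0 ->
  forall j, (j < o n)%N -> x j = 0.
Proof.
move=> x0 j jn; apply/normr0_eq0/le_anti; rewrite normr_ge0 andbT.
by rewrite (le_trans (le_coord_block_norm x jn))// x0 mul0r.
Qed.

Lemma block_norm_continuous (T : topologicalType) (f : T -> nat -> R) n :
  (forall j, continuous (f ^~ j)) -> continuous (fun t => block_norm n (f t)).
Proof.
move=> cf t; have [c cP] := bb_bound.
(* A seminorm in finitely many coordinates is Lipschitz for the l_1 distance weighted by bounds
   [c j] of the coordinate functionals. *)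
have lip x y : block_norm n x <=
    block_norm n y + \sum_(0 <= j < o n) `|x j - y j| * c j.
  apply: (@le_trans _ _ (block_norm n y + block_norm n (fun j => x j - y j))).
    apply: le_trans (block_normD n y _); rewrite le_eqVlt; apply/orP; left.
    by apply/eqP/block_norm_congr => j _; ring.
  rewrite lerD2l; apply: block_norm_le => z z1.
  rewrite (le_trans (ler_norm_sum _ _ _))//; apply: ler_sum => j _.
  by rewrite normrM ler_wpM2l// cP.
apply/cvgrPdist_le => eps eps0.
pose g u := \sum_(0 <= j < o n) `|f t j - f u j| * c j.
have : g @ t --> \sum_(0 <= j < o n) `|f t j - f t j| * c j.
  apply: cvg_sumr => j _; apply: cvgMr_tmp; apply: cvg_norm.
  by apply: cvgB; [exact: cvg_cst|exact: cf].
rewrite big1; last by move=> j _; rewrite subrr normr0 mul0r.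
move=> /(_ [set y | y < eps]) /(_ (lt_nbhsl eps0)) gt.
have : \forall u \near t, g u < eps by exact: gt.
apply: filterS => u ge.
rewrite ler_distlC; apply/andP; split.
  rewrite lerBlDr (le_trans (lip _ (f u)))// lerD2l.
  exact: ltW.
rewrite (le_trans (lip _ (f t)))// lerD2l.
apply: le_trans (ltW ge); apply: ler_sum => j _.
by rewrite distrC.
Qed.

End block_norm.

(** * The homeomorphism between the dual balls *)

Section damped_norm.
Context {R : realType} {X : normedModType R} {e : nat -> X}
  {e' : nat -> X -> R} {o : nat -> nat} (bb : block_basis e e' o).

Local Notation N := (@block_norm R X e' o).
Local Notation blk := (block_index (bb_oS bb)).
Local Notation blkP := (block_indexP (bb_o0 bb) (bb_oS bb)).
Local Notation blkE := (block_indexE (bb_o0 bb) (bb_oS bb)).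
Local Notation blk_lt := (block_index_lt (bb_o0 bb) (bb_oS bb)).

Definition blk_abs n (x : nat -> R) := \sum_(o n <= j < o n.+1) `|x j|.

Lemma blk_abs_ge0 n x : 0 <= blk_abs n x.
Proof. exact: sumr_ge0. Qed.

Lemma blk_abs_eq0 n x : blk_abs n x = 0 ->
  forall j, (o n <= j < o n.+1)%N -> x j = 0.
Proof.
move=> /eqP; rewrite psumr_eq0// => /allP x0 j jn; apply/normr0_eq0/eqP.
by have := x0 j; rewrite mem_index_iota jn; exact.
Qed.

Lemma blk_abs_congr n x y :
  (forall j, (o n <= j < o n.+1)%N -> x j = y j) -> blk_abs n x = blk_abs n y.
Proof. by move=> xy; apply: eq_big_nat => j /xy ->. Qed.

Lemma blk_absZ n c x : blk_abs n (fun j => c * x j) = `|c| * blk_abs n x.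
Proof.
by rewrite /blk_abs mulr_sumr; apply: eq_bigr => j _; rewrite normrM.
Qed.

Lemma block_norm_flat n x : blk_abs n x = 0 -> N n.+1 x = N n x.
Proof.
move=> x0; congr (sup (_ @` _)); apply/funext => z; congr `|_|.
rewrite /bb_coef (@big_cat_nat _ _ _ (o n))//=;
  last exact: (offset_mono (bb_oS bb)).
rewrite [X in _ + X]big_nat [X in _ + X]big1 ?addr0// => j jn.
by rewrite (blk_abs_eq0 x0 jn) mul0r.
Qed.

(* Equal to [0 / 0 = 0] when [x] vanishes on the blocks [0, ..., k]. *)
Definition ratio k x := blk_abs k x / (N k x + blk_abs k x).

Lemma ratio_ge0 k x : 0 <= ratio k x.
Proof. by rewrite divr_ge0 ?addr_ge0 ?blk_abs_ge0 ?(block_norm_ge0 bb). Qed.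

Lemma ratio_le1 k x : ratio k x <= 1.
Proof.
have [s0|s0] := eqVneq (N k x + blk_abs k x) 0.
  by rewrite /ratio s0 invr0 mulr0.
rewrite ler_pdivrMr ?mul1r ?lerDr ?(block_norm_ge0 bb)//.
by rewrite lt0r s0 addr_ge0 ?blk_abs_ge0 ?(block_norm_ge0 bb).
Qed.

Lemma ratio_congr k x y : (forall j, (j < o k.+1)%N -> x j = y j) ->
  ratio k x = ratio k y.
Proof.
move=> xy; rewrite /ratio (@blk_abs_congr _ _ y); last by move=> j /andP[_ /xy].
rewrite (@block_norm_congr _ _ _ _ _ _ y)// => j jk; apply: xy.
exact: leq_trans jk (offset_mono (bb_oS bb) (leqnSn k)).
Qed.

Lemma ratioZ k c x : 0 < c -> ratio k (fun j => c * x j) = ratio k x.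
Proof.
move=> c0; rewrite /ratio blk_absZ (block_normZ bb) gtr0_norm// -mulrDr.
by rewrite -mulf_div divff ?mul1r// gt_eqF.
Qed.

Definition damp n x := \sum_(0 <= k < n) 2 ^- k.+1 * ratio k x.

Lemma damp_congr n x y : (forall j, (j < o n)%N -> x j = y j) ->
  damp n x = damp n y.
Proof.
move=> xy; apply: eq_big_nat => k /andP[_ kn]; congr (_ * _).
by apply: ratio_congr => j jk; apply: xy;
  exact: leq_trans jk (offset_mono (bb_oS bb) kn).
Qed.

Lemma dampZ n c x : 0 < c -> damp n (fun j => c * x j) = damp n x.
Proof. by move=> c0; apply: eq_bigr => k _; rewrite ratioZ. Qed.

Lemma dampS n x : damp n.+1 x = damp n x + 2 ^- n.+1 * ratio n x.
Proof. by rewrite /damp big_nat_recr. Qed.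

Lemma damp_bounds n m x : (n <= m)%N ->
  damp n x <= damp m x <= damp n x + (2 ^- n - 2 ^- m).
Proof.
elim: m => [|m ih]; first by rewrite leqn0 => /eqP ->; rewrite subrr addr0 lexx.
rewrite leq_eqVlt => /predU1P[->|]; first by rewrite subrr addr0 lexx.
move=> /ih /andP[h1 h2]; rewrite dampS; have := @exp2NS R m.
have := ratio_ge0 m x; have := ratio_le1 m x.
have := @exp2N_gt0 R m.+1; set p := 2 ^- m.+1;
  set q := ratio m x => p0 q1 q0 pE.
have := ler_piMr (ltW p0) q1; have := mulr_ge0 (ltW p0) q0; lra.
Qed.

(** The sum of the whole series, since its terms are nonnegative. *)
Definition damp_sup x := sup (range (damp ^~ x)).

Lemma damp_sup_bounds n x : damp n x <= damp_sup x <= damp n x + 2 ^- n.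
Proof.
have ub m : damp m x <= damp n x + 2 ^- n.
  have [mn|/ltnW nm] := leqP m n.
    have /andP[h _] := damp_bounds x mn; rewrite (le_trans h)// lerDl.
    exact: ltW (exp2N_gt0 n).
  have /andP[_ h] := damp_bounds x nm; rewrite (le_trans h)// lerD2l.
  by rewrite gerBl ltW// exp2N_gt0.
apply/andP; split.
  apply: ub_le_sup; last by exists n.
  by exists (damp n x + 2 ^- n) => _ [m _ <-]; exact: ub.
apply: ge_sup; first by exists (damp n x), n.
by move=> _ [m _ <-]; exact: ub.
Qed.

Lemma damp_supZ c x : 0 < c -> damp_sup (fun j => c * x j) = damp_sup x.
Proof.
move=> c0; rewrite /damp_sup (_ : damp ^~ _ = damp ^~ x)//.
by apply/funext => n; exact: dampZ.
Qed.

(* [N n.+1] may be constant near the origin of the [n]-th block, whereas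
   [dnorm n.+1] increases strictly along the rays of this block. *)
Definition dnorm n x := expR (damp n x) * N n x.

Lemma dnorm_congr n x y : (forall j, (j < o n)%N -> x j = y j) ->
  dnorm n x = dnorm n y.
Proof.
by move=> xy; rewrite /dnorm (damp_congr xy) (block_norm_congr xy).
Qed.

Lemma dnormZ n c x : 0 < c -> dnorm n (fun j => c * x j) = c * dnorm n x.
Proof.
by move=> c0; rewrite /dnorm dampZ// (block_normZ bb) gtr0_norm// mulrCA.
Qed.

Lemma dnorm_ge0 n x : 0 <= dnorm n x.
Proof. by rewrite mulr_ge0 ?expR_ge0 ?(block_norm_ge0 bb). Qed.

Lemma dnorm_flat n x : blk_abs n x = 0 -> dnorm n.+1 x = dnorm n x.
Proof.
by move=> x0; rewrite /dnorm dampS /ratio x0 mul0r mulr0 addr0 block_norm_flat.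
Qed.

Lemma dnorm_mono n x : dnorm n x <= dnorm n.+1 x.
Proof.
rewrite ler_pM ?expR_ge0 ?(block_norm_ge0 bb) ?(block_norm_mono bb)//.
by rewrite ler_expR; have /andP[] := damp_bounds x (leqnSn n).
Qed.

(** With [eq0_block_normS], the denominator of [ratio n] vanishes exactly where [N n.+1] does;
    elsewhere [ratio n] is continuous. *)
Lemma block_normS_eq0 n x : N n.+1 x = 0 -> N n x + blk_abs n x = 0.
Proof.
move=> x0; have : N n x <= 0 by rewrite -x0 (block_norm_mono bb).
move=> Nx; have -> : N n x = 0 by apply/le_anti; rewrite Nx (block_norm_ge0 bb).
rewrite add0r /blk_abs big_nat big1// => j /andP[_ jn].
by rewrite (block_norm_eq0 bb x0 jn) normr0.
Qed.

Lemma eq0_block_normS n x : N n x + blk_abs n x = 0 -> N n.+1 x = 0.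
Proof.
have := block_norm_ge0 bb n x; have := blk_abs_ge0 n x => ax Nx s0.
have a0 : blk_abs n x = 0 by lra.
by rewrite (block_norm_flat a0); lra.
Qed.

(** Up to index [o n.+1], [x] is a convex combination of [y] and of [y0], which is [y] with its
    [n]-th block erased. This bounds [N n.+1 x] by convexity. *)
Lemma dnorm_strict n t x y : 0 <= t < 1 ->
  (forall j, (j < o n)%N -> x j = y j) ->
  (forall j, (o n <= j < o n.+1)%N -> x j = t * y j) ->
  blk_abs n y != 0 -> dnorm n.+1 x < dnorm n.+1 y.
Proof.
move=> /andP[t0 t1] xy xty ay.
have a0 : 0 < blk_abs n y by rewrite lt0r ay blk_abs_ge0.
have Nxy : N n x = N n y by exact: block_norm_congr.
have axy : blk_abs n x = t * blk_abs n y.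
  by rewrite -[in RHS](ger0_norm t0) -blk_absZ; exact: blk_abs_congr.
pose y0 j := if (j < o n)%N then y j else 0.
have Ny0 : N n.+1 y0 = N n y.
  rewrite block_norm_flat.
    by apply: block_norm_congr => j jn; rewrite /y0 jn.
  rewrite /blk_abs big_nat big1// => j /andP[nj _].
  by rewrite /y0 ltnNge nj/= normr0.
have Nx : N n.+1 x <= t * N n.+1 y + (1 - t) * N n y.
  have -> : N n.+1 x = N n.+1 (fun j => t * y j + (1 - t) * y0 j).
    apply: block_norm_congr => j jn; rewrite /y0; case: ltnP => jo.
      by rewrite xy//; ring.
    by rewrite mulr0 addr0 xty// jo.
  rewrite (le_trans (block_normD bb _ _ _))// !(block_normZ bb) Ny0.
  by rewrite !ger0_norm// subr_ge0 ltW.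
have NSy : 0 < N n.+1 y.
  rewrite lt0r (block_norm_ge0 bb) andbT;
    apply: contraNneq ay => /block_normS_eq0.
  by have := block_norm_ge0 bb n y; lra.
have NnS : N n y <= N n.+1 y by exact: (block_norm_mono bb).
have Dxy : damp n x = damp n y by exact: damp_congr.
have r0 := block_norm_ge0 bb n y.
rewrite /dnorm !dampS Dxy !expRD -!mulrA ltr_pM2l ?expR_gt0//.
have NxS : N n.+1 x <= N n.+1 y.
  have t1' : 0 <= 1 - t by rewrite subr_ge0 ltW.
  by have := ler_wpM2l t1' NnS; move: Nx; lra.
(* If [N n y = 0], strictness comes from [N n.+1 x <= t * N n.+1 y]; otherwise from the strict
   growth of [a / (r + a)] in [a]. *)
have [r00|rn0] := eqVneq (N n y) 0.
  have qy : ratio n y = 1 by rewrite /ratio r00 add0r divff.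
  apply: (@le_lt_trans _ _ (expR (2 ^- n.+1 * ratio n y) * N n.+1 x)).
    rewrite ler_wpM2r ?(block_norm_ge0 bb)// ler_expR ler_pM2l ?exp2N_gt0//.
    by rewrite qy ratio_le1.
  rewrite ltr_pM2l ?expR_gt0// (le_lt_trans Nx)// r00 mulr0 addr0.
  by rewrite gtr_pMl.
apply: (@le_lt_trans _ _ (expR (2 ^- n.+1 * ratio n x) * N n.+1 y)).
  by rewrite ler_pM2l ?expR_gt0.
rewrite ltr_pM2r// ltr_expR ltr_pM2l ?exp2N_gt0//.
have rp : 0 < N n y by rewrite lt0r rn0.
rewrite /ratio Nxy axy ltr_pdivrMr ?ltr_wpDr ?mulr_ge0 ?blk_abs_ge0//.
rewrite mulrAC ltr_pdivlMr ?addr_gt0//.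
move: (blk_abs n y) (N n y) a0 rp => a r a0 rp.
have : 0 < a * r * (1 - t) by rewrite !mulr_gt0// subr_gt0.
lra.
Qed.

Lemma dnorm_lt n x : blk_abs n x != 0 -> dnorm n x < dnorm n.+1 x.
Proof.
move=> ax; pose y j := if (j < o n)%N then x j else 0.
have yn j : (o n <= j < o n.+1)%N -> y j = 0.
  by move=> /andP[nj _]; rewrite /y ltnNge nj.
have yx j : (j < o n)%N -> y j = x j by rewrite /y => ->.
rewrite -(dnorm_congr yx) -dnorm_flat; last first.
  by rewrite /blk_abs big_nat big1// => j /yn ->; rewrite normr0.
apply: (@dnorm_strict _ 0) => //; first by rewrite lexx ltr01.
by move=> j /yn ->; rewrite mul0r.
Qed.

(* Keeps the direction of [x] in each block, and changes its l_1 norm there to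
   the increment of [dnorm]. *)
Definition psi x j :=
  (dnorm (blk j).+1 x - dnorm (blk j) x) * (x j / blk_abs (blk j) x).

Lemma psi_congr n x y : (forall j, (j < o n)%N -> x j = y j) ->
  forall j, (j < o n)%N -> psi x j = psi y j.
Proof.
move=> xy j jn; have bn := blk_lt jn.
have xyS i : (i < o (blk j).+1)%N -> x i = y i.
  by move=> ij; apply: xy; exact: leq_trans ij (offset_mono (bb_oS bb) bn).
rewrite /psi (dnorm_congr xyS) (xy j)//; congr (_ * (_ / _)).
  congr (_ - _); apply: dnorm_congr => i ij; apply: xyS.
  exact: leq_trans ij (offset_mono (bb_oS bb) (leqnSn _)).
by apply: blk_abs_congr => i /andP[_ /xyS].
Qed.

Lemma psiZ c x j : 0 < c -> psi (fun j => c * x j) j = c * psi x j.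
Proof.
move=> c0; rewrite /psi !dnormZ// blk_absZ gtr0_norm//.
by rewrite -mulrBr -mulf_div divff ?gt_eqF// mul1r -mulrA.
Qed.

Lemma psi_blk n x : blk_abs n (psi x) = dnorm n.+1 x - dnorm n x.
Proof.
have [ax|ax] := eqVneq (blk_abs n x) 0.
  rewrite dnorm_flat// subrr /blk_abs big_nat big1// => j jn.
  by rewrite /psi (blk_abs_eq0 ax jn) mul0r mulr0 normr0.
transitivity (\sum_(o n <= j < o n.+1)
    (dnorm n.+1 x - dnorm n x) / blk_abs n x * `|x j|).
  apply: eq_big_nat => j jn; rewrite /psi (blkE jn).
  have h : 0 <= (dnorm n.+1 x - dnorm n x) / blk_abs n x.
    by rewrite divr_ge0 ?blk_abs_ge0// subr_ge0 dnorm_mono.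
  by rewrite -[in RHS](ger0_norm h) -normrM mulrA mulrAC.
by rewrite -mulr_sumr divfK.
Qed.

Lemma psi_sum n x : \sum_(0 <= j < o n) `|psi x j| = dnorm n x.
Proof.
elim: n => [|n ih].
  by rewrite (bb_o0 bb) big_geq// /dnorm (block_norm0 bb) mulr0.
rewrite (@big_cat_nat _ _ _ (o n))//=; last exact: (offset_mono (bb_oS bb)).
by rewrite ih -[X in _ + X]/(blk_abs n (psi x)) psi_blk addrC subrK.
Qed.

(** Block by block: the partial l_1 sums of [psi x] recover [dnorm], quotients recover the direction
    in the block, and strict growth along its ray recovers the length. *)
Lemma psi_inj x y : psi x = psi y -> x = y.
Proof.
move=> pxy; suff xy n j : (j < o n)%N -> x j = y j.
  by apply/funext => j; apply: (xy j.+1); exact: (leq_offset (bb_oS bb)).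
elim: n j => [j|n ih j]; first by rewrite (bb_o0 bb).
have [/ih//|nj jn] := ltnP j (o n).
have {nj}jn : (o n <= j < o n.+1)%N by rewrite nj.
have Dxy : dnorm n.+1 x = dnorm n.+1 y.
  by rewrite -!psi_sum; apply: eq_bigr => i _; rewrite pxy.
have D0xy : dnorm n x = dnorm n y by exact: dnorm_congr.
have [ax|ax] := eqVneq (blk_abs n x) 0.
  have ay : blk_abs n y = 0.
    by apply: contraTeq isT => /dnorm_lt; rewrite -Dxy -D0xy dnorm_flat// ltxx.
  by rewrite (blk_abs_eq0 ax jn) (blk_abs_eq0 ay jn).
have [ay|ay] := eqVneq (blk_abs n y) 0.
  by have := dnorm_lt ax; rewrite Dxy D0xy dnorm_flat// ltxx.
have Dn0 : dnorm n.+1 x - dnorm n x != 0 by rewrite subr_eq0 gt_eqF// dnorm_lt.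
have prop i : (o n <= i < o n.+1)%N -> x i / blk_abs n x = y i / blk_abs n y.
  move=> ib; have := congr1 (fun f => f i) pxy.
  by rewrite /psi (blkE ib) -Dxy -D0xy => /(mulfI Dn0).
(* If the block of [u] were shorter, [dnorm_strict] would apply with the quotient of the two lengths
   as [t]. *)
have wlt u v : (forall i, (i < o n)%N -> u i = v i) -> blk_abs n v != 0 ->
    (forall i, (o n <= i < o n.+1)%N ->
      u i / blk_abs n u = v i / blk_abs n v) ->
    blk_abs n u != 0 -> dnorm n.+1 u = dnorm n.+1 v ->
      blk_abs n v <= blk_abs n u.
  move=> uv av puv au Duv; rewrite leNgt; apply/negP => ltuv.
  have av0 : 0 < blk_abs n v by rewrite lt0r av blk_abs_ge0.
  have := @dnorm_strict n (blk_abs n u / blk_abs n v) u v.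
  rewrite Duv ltxx => H; suff : false by []; apply: H => //.
    by rewrite divr_ge0 ?blk_abs_ge0//= ltr_pdivrMr// mul1r.
  by move=> i ib; rewrite mulrAC -mulrA -puv// mulrC divfK.
have axy : blk_abs n x = blk_abs n y.
  apply/le_anti/andP; split; apply: wlt => //.
  - by move=> i /ih.
  - by move=> i ib; rewrite prop.
have := prop j jn; rewrite axy => /(mulIf _); apply.
by rewrite invr_eq0.
Qed.

(** The exponent is minus the tail of the series from [n] on. *)
Definition tail_norm n x := expR (damp n x - damp_sup x) * N n x.

Section family.
Context {T : topologicalType} (f : T -> nat -> R).
Hypothesis cf : forall j, continuous (f ^~ j).

Let cN n : continuous (fun t => N n (f t)).
Proof. exact: (block_norm_continuous bb cf). Qed.

Lemma blk_abs_continuous n : continuous (fun t => blk_abs n (f t)).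
Proof. by move=> t; apply: cvg_sumr => j _; apply: cvg_norm; exact: cf. Qed.

Lemma ratio_continuous k t : N k.+1 (f t) != 0 ->
  {for t, continuous (fun t => ratio k (f t))}.
Proof.
move=> Nk; apply: cvgM; first exact: blk_abs_continuous.
apply: cvgV; first by apply: contraNneq Nk => /eq0_block_normS ->.
by apply: cvgD; [exact: cN|exact: blk_abs_continuous].
Qed.

(** This is [dnorm n.+1] without the factor [expR (damp n)], which is constant while the first [n]
    blocks are fixed. *)
Lemma dnorm_step_continuous n :
  continuous (fun t => expR (2 ^- n.+1 * ratio n (f t)) * N n.+1 (f t)).
Proof.
apply: (@bounded_mul_continuous _ _ _ _ (expR (2 ^- n.+1))).
- exact: cN.
- move=> t; rewrite ger0_norm ?expR_ge0// ler_expR.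
  by apply: ler_piMr; [exact/ltW/exp2N_gt0|exact: ratio_le1].
- move=> t Nn; apply: (@continuous_comp _ _ _ _ expR);
  last exact: continuous_expR.
  by apply: cvgMl_tmp; exact: ratio_continuous.
Qed.

(** Where [N n] is nonzero, so are all later block norms, hence every ratio in the tail is
    continuous and the tail converges uniformly. Where [N n] vanishes, the exponential is bounded by
    1. *)
Lemma tail_norm_continuous n : continuous (fun t => tail_norm n (f t)).
Proof.
apply: (@bounded_mul_continuous _ _ _ _ 1).
- exact: cN.
- move=> t; rewrite ger0_norm ?expR_ge0// -expR0 ler_expR subr_le0.
  by have /andP[] := damp_sup_bounds n (f t).
move=> t Nn; apply: (@continuous_comp _ _ _ _ expR);
  last exact: continuous_expR.
pose S m u := \sum_(0 <= i < m) 2 ^- (n + i).+1 * ratio (n + i) (f u).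
have SE m u : damp (n + m) (f u) = damp n (f u) + S m u.
  elim: m => [|m ih]; first by rewrite addn0 /S big_geq// addr0.
  by rewrite addnS dampS ih /S big_nat_recr//= addrA.
have cS m : S m u @[u --> t] --> S m t.
  apply: cvg_sumr => i _; apply: cvgMl_tmp; apply: ratio_continuous.
  rewrite gt_eqF//; apply: (@lt_le_trans _ _ (N n (f t))).
    by rewrite lt0r Nn (block_norm_ge0 bb).
  by apply: (block_norm_mono bb); lia.
apply/cvgrPdist_le => eps eps0.
(* The remainders at [t] and [u] cost [eps / 4] each, the finite sum [S m] costs [eps / 2]. *)
have [m mP] : exists m, 2 ^- (n + m) <= eps / 4 :> R.
  have [m mP] := exp2N_small (divr_gt0 eps0 (ltr0n _ 4)).
  by exists m; rewrite (le_trans _ mP)// exp2N_le// leq_addl.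
have e20 : 0 < eps / 2 by rewrite divr_gt0.
have /cvgrPdist_le/(_ _ e20) := cS m.
apply: filterS => u; have := SE m u; have := SE m t.
have /andP[] := damp_sup_bounds (n + m) (f u).
have /andP[] := damp_sup_bounds (n + m) (f t).
rewrite !ler_distl; move: mP; lra.
Qed.

End family.

(** Solves [psi x = w] in the [n]-th block once the earlier blocks are given, by the intermediate
    value theorem along the ray of [w]. *)
Lemma psi_step n x w : exists theta, 0 <= theta /\
  let y := fun j => if (j < o n)%N then x j else theta * w j in
  dnorm n.+1 y - dnorm n y = blk_abs n w.
Proof.
pose y theta := fun j => if (j < o n)%N then x j else theta * w j.
have yx theta j : (j < o n)%N -> y theta j = x j by rewrite /y => ->.
have yw theta j : (o n <= j < o n.+1)%N -> y theta j = theta * w j.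
  by move=> /andP[nj _]; rewrite /y ltnNge nj.
have Dy theta : dnorm n (y theta) = dnorm n x by apply: dnorm_congr => j /yx.
suff [theta th0 h] : exists2 theta, 0 <= theta &
    dnorm n.+1 (y theta) = dnorm n x + blk_abs n w.
  by exists theta; split => //=; rewrite -/(y theta) h Dy addrAC subrr add0r.
have D0 : dnorm n.+1 (y 0) = dnorm n x.
  rewrite dnorm_flat// /blk_abs big_nat big1// => j jn.
  by rewrite yw// mul0r normr0.
have [aw|aw] := eqVneq (blk_abs n w) 0; first by exists 0; rewrite ?aw ?addr0.
have [j jn wj] : exists2 j, (o n <= j < o n.+1)%N & w j != 0.
  apply: contrapT => H; move: aw; rewrite /blk_abs big_nat big1 ?eqxx// => j jn.
  by apply/normr0P/negP => /negP wj; apply: H; exists j.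
have ej : 0 < `|e j|.
  rewrite normr_gt0; apply/eqP => ej0; have := bb_dual bb j j.
  by rewrite eqxx ej0 (scalar_fun0 (bb_scalar bb j)) => /eqP;
    rewrite eq_sym oner_eq0.
(* At this factor the [j]-th coordinate alone forces [N n.+1] up to the target, and the exponential
   factor is at least 1. *)
pose Theta := (dnorm n x + blk_abs n w) * `|e j| / `|w j|.
have wj0 : 0 < `|w j| by rewrite normr_gt0.
have S0 : 0 <= dnorm n x + blk_abs n w.
  by rewrite addr_ge0 ?dnorm_ge0 ?blk_abs_ge0.
have Theta0 : 0 <= Theta by rewrite !mulr_ge0// invr_ge0.
have DTheta : dnorm n x + blk_abs n w <= dnorm n.+1 (y Theta).
  have jo : (j < o n.+1)%N by case/andP: jn.
  have := le_coord_block_norm bb (y Theta) jo.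
  rewrite yw// normrM ger0_norm// divfK ?gt_eqF// ler_pM2r// => /le_trans;
    apply.
  rewrite /dnorm ler_peMl ?(block_norm_ge0 bb)// -expR0 ler_expR.
  by apply: sumr_ge0 => k _; rewrite mulr_ge0 ?ratio_ge0// ltW// exp2N_gt0.
have cD : continuous (fun theta => dnorm n.+1 (y theta)).
  have -> : (fun theta => dnorm n.+1 (y theta)) = (fun theta =>
    expR (damp n x) *
      (expR (2 ^- n.+1 * ratio n (y theta)) * N n.+1 (y theta))).
    apply/funext => theta; rewrite /dnorm dampS expRD -mulrA.
    by rewrite (@damp_congr n (y theta) x)// => i /yx.
  move=> theta; apply: cvgMl_tmp; apply: (@dnorm_step_continuous _ y) => i u.
  have [ni|ni] := ltnP i (o n).
    rewrite (_ : y ^~ i = fun=> x i); first exact: cst_continuous.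
    by apply/funext => th; rewrite /y ni.
  rewrite (_ : y ^~ i = fun th => th * w i).
    by apply: cvgMr_tmp; exact: cvg_id.
  by apply/funext => th; rewrite /y ltnNge ni.
have [|theta th0 h] := @IVT _ _ 0 Theta (dnorm n x + blk_abs n w) Theta0
    (continuous_subspaceT cD); last first.
  by exists theta => //; move: th0; rewrite in_itv/= => /andP[].
by rewrite D0 ge_min le_max lerDl blk_abs_ge0 DTheta orbT.
Qed.

Lemma psi_surj w : exists x, psi x = w.
Proof.
have [th thP] := choice (fun xn : (nat -> R) * nat => psi_step xn.2 xn.1 w).
(* [X_ n] solves the first [n] blocks, and later [X_ m] agree with it there; [x] is the common
   extension. *)
pose X_ := fix X_ n : nat -> R := if n is m.+1 then
  fun j => if (j < o m)%N then X_ m j else th (X_ m, m) * w j else fun=> 0.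
pose x j := X_ (blk j).+1 j.
have XE n m j : (n <= m)%N -> (j < o n)%N -> X_ m j = X_ n j.
  elim: m => [|m ih]; first by rewrite leqn0 => /eqP ->.
  rewrite leq_eqVlt => /predU1P[<-//|nm] jn; rewrite /= (leq_trans jn) ?ih//.
  exact: (offset_mono (bb_oS bb)).
have xX n j : (j < o n)%N -> x j = X_ n j.
  move=> jn; rewrite /x (XE _ _ _ (blk_lt jn))//.
  by have /andP[] := blkP j.
exists x; apply/funext => j; set n := blk j.
have /andP[nj jn] : (o n <= j < o n.+1)%N := blkP j.
have [th0 DX] : 0 <= th (X_ n, n) /\
  dnorm n.+1 (X_ n.+1) - dnorm n (X_ n.+1) = blk_abs n w := thP (X_ n, n).
have wX i : (o n <= i < o n.+1)%N -> X_ n.+1 i = th (X_ n, n) * w i.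
  by move=> /andP[ni _]; rewrite /= ltnNge ni.
rewrite (@psi_congr n.+1 x (X_ n.+1))//; last exact: xX.
have jb : (o n <= j < o n.+1)%N by rewrite nj.
rewrite /psi -/n DX wX//.
have [aw|aw] := eqVneq (blk_abs n w) 0.
  by rewrite (blk_abs_eq0 aw jb) aw mul0r.
have aXE : blk_abs n (X_ n.+1) = th (X_ n, n) * blk_abs n w.
  by rewrite -[in RHS](ger0_norm th0) -blk_absZ; exact: blk_abs_congr.
(* A zero factor would leave [dnorm] unchanged across the block. *)
have thn0 : th (X_ n, n) != 0.
  apply: contra_neq aw => th00; rewrite -DX dnorm_flat ?subrr//.
  by rewrite aXE th00 mul0r.
by rewrite aXE; field; rewrite aw.
Qed.

Lemma tail_normE n x : tail_norm n x = expR (- damp_sup x) * dnorm n x.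
Proof. by rewrite /tail_norm /dnorm mulrA -expRD addrC. Qed.

Lemma tail_norm_le n x : tail_norm n x <= N n x.
Proof.
rewrite ler_piMl ?(block_norm_ge0 bb)// -expR0 ler_expR subr_le0.
by have /andP[] := damp_sup_bounds n x.
Qed.

(* In [psi x / expR (damp_sup x)] the ratios of the preceding blocks cancel out:
   these are the ones that make [psi] discontinuous, since [ratio k] is not
   continuous where the blocks [0, ..., k] vanish. *)
Definition phi x j :=
  x j / blk_abs (blk j) x * (tail_norm (blk j).+1 x - tail_norm (blk j) x).

Lemma phiE x j : phi x j = expR (- damp_sup x) * psi x j.
Proof. by rewrite /phi /psi !tail_normE; ring. Qed.

(** The quotient by [blk_abs] is bounded by 1 and continuous where the block is nonzero; where the
    block is zero, the difference of tail norms vanishes. *)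
Lemma phi_continuous (T : topologicalType) (f : T -> nat -> R) j :
  (forall j, continuous (f ^~ j)) -> continuous (fun t => phi (f t) j).
Proof.
move=> cf; apply: (@bounded_mul_continuous _ _ _ _ 1).
- by move=> t; apply: cvgB; exact: (tail_norm_continuous cf).
- move=> t; have [a0|a0] := eqVneq (blk_abs (blk j) (f t)) 0.
    by rewrite a0 invr0 mulr0 normr0.
  rewrite normrM normfV (ger0_norm (blk_abs_ge0 _ _)) ler_pdivrMr; last first.
    by rewrite lt0r a0 blk_abs_ge0.
  rewrite mul1r /blk_abs (bigD1_seq j) ?iota_uniq ?mem_index_iota ?blkP//=.
  by rewrite lerDl sumr_ge0.
- move=> t; rewrite !tail_normE -mulrBr => a0.
  apply: cvgM; first exact: cf.
  apply: cvgV; last exact: (blk_abs_continuous cf).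
  by apply: contraNneq a0 => /dnorm_flat ->; rewrite subrr mulr0.
Qed.

Lemma phi_sum n x : \sum_(0 <= j < o n) `|phi x j| = tail_norm n x.
Proof.
rewrite tail_normE -psi_sum mulr_sumr; apply: eq_bigr => j _.
by rewrite phiE normrM ger0_norm// expR_ge0.
Qed.

Lemma phiZ c x j : 0 <= c -> phi (fun j => c * x j) j = c * phi x j.
Proof.
rewrite le0r => /predU1P[->|c0]; first by rewrite /phi !mul0r.
by rewrite !phiE damp_supZ// psiZ// mulrCA.
Qed.

(** Equal images give [psi x = psi (c * y)], so [x] is a positive multiple of [y]; scale invariance
    of [damp_sup] then forces [c = 1]. *)
Lemma phi_inj x y : phi x = phi y -> x = y.
Proof.
move=> pxy; pose c := expR (damp_sup x - damp_sup y).
have c0 : 0 < c by exact: expR_gt0.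
have xcy : x = (fun j => c * y j).
  apply: psi_inj; apply/funext => j; rewrite psiZ//.
  have := congr1 (fun f => expR (damp_sup x) * f j) pxy.
  by rewrite /= !phiE !(mulrA (expR _) (expR _)) -!expRD subrr expR0 mul1r.
have : c = 1 by rewrite /c xcy damp_supZ// subrr expR0.
by move=> c1; rewrite xcy c1; apply/funext => j; rewrite mul1r.
Qed.

(** Scaling a [psi]-preimage by [expR (damp_sup x)] keeps [damp_sup] and cancels the factor in
    [phiE]. *)
Lemma phi_surj w : exists x, phi x = w.
Proof.
have [x xw] := psi_surj w; exists (fun j => expR (damp_sup x) * x j).
apply/funext => j; rewrite phiE damp_supZ ?expR_gt0// psiZ ?expR_gt0//.
by rewrite mulrA -expRD addNr expR0 mul1r xw.
Qed.

(** The bound on [tail_norm k x] gives [N k x <= expR (2 ^- k)], and [N n x <= N k x] for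
    arbitrarily large [k]. *)
Lemma phi_block_norm_le1 x :
  (forall n, \sum_(0 <= j < o n) `|phi x j| <= 1) -> forall n, N n x <= 1.
Proof.
move=> x1 n; rewrite leNgt; apply/negP => N1.
have l0 : 0 < ln (N n x) by exact: ln_gt0.
have [m mP] := exp2N_small (divr_gt0 l0 (ltr0n _ 2)).
have : N n x <= expR (2 ^- (n + m)).
  rewrite (le_trans (block_norm_mono bb x (leq_addr m n)))//.
  have := x1 (n + m)%N; rewrite phi_sum /tail_norm mulrC -ler_pdivlMr
    ?expR_gt0//.
  rewrite mul1r -expRN => /le_trans; apply; rewrite ler_expR opprB lerBlDl.
  by have /andP[] := damp_sup_bounds (n + m) x.
have -> : N n x = expR (ln (N n x)) by rewrite lnK// posrE (lt_trans ltr01).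
rewrite ler_expR leNgt => /negP; apply.
apply: (@le_lt_trans _ _ (2 ^- m)).
  by rewrite exp2N_le// leq_addl.
by rewrite (le_lt_trans mP)// ltr_pdivrMr// ltr_pMr// ltr1n.
Qed.
End damped_norm.

(** * Points of the dual ball as coordinate sequences *)

Section functionals.
Context {R : realType} {X : normedModType R} {e : nat -> X}
  {e' : nat -> X -> R} {o : nat -> nat} (bb : block_basis e e' o).

Local Notation N := (@block_norm R X e' o).
Local Notation proj := (@bb_proj R X e e' o).
Local Notation coef := (@bb_coef R X e' o).

Definition coords (s : dual_ball X) j := delta (e j) s.

Lemma coords_proj n s z : coef n (coords s) z = delta (proj n z) s.
Proof. by rewrite delta_sum; apply: eq_bigr => j _; rewrite deltaZ mulrC. Qed.

Lemma coords_norm_le1 n s : N n (coords s) <= 1.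
Proof.
apply: block_norm_le => z z1; rewrite coords_proj (le_trans (le_delta _ _))//.
exact: le_trans (bb_contr bb n z) z1.
Qed.

Lemma coords_approx n s z :
  `|delta z s - coef n (coords s) z| <= `|z - proj n z|.
Proof. by rewrite coords_proj -deltaB le_delta. Qed.

Lemma proj_approx z eps : 0 < eps -> exists n, `|z - proj n z| <= eps.
Proof.
move=> eps0; have /cvgrPdist_le/(_ _ eps0)[n _ h] := bb_cvg bb z.
by exists n; exact: (h n (leqnn n)).
Qed.

Lemma coords_cvg s z : coef n (coords s) z @[n --> \oo] --> delta z s.
Proof.
apply/cvgrPdist_le => eps eps0.
have /cvgrPdist_le/(_ _ eps0) := bb_cvg bb z.
by apply: filterS => n; apply: le_trans; exact: coords_approx.
Qed.

Lemma coords_inj : injective coords.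
Proof.
move=> s t st; apply/val_inj/funext => z;
  apply: (@cvg_unique _ _ (coef n (coords s) z @[n --> \oo])).
- exact: Rhausdorff.
- exact: coords_cvg.
- by rewrite st; exact: coords_cvg.
Qed.

(** The functional is the pointwise limit of [coef n x]: for [m >= n] the values at [z] differ by at
    most [|z - proj n z|], which makes them Cauchy. *)
Lemma coords_surj x : (forall n, N n x <= 1) -> exists s, coords s = x.
Proof.
move=> x1.
have cx n z : `|coef n x z| <= `|z|.
  by rewrite (le_trans (le_block_norm bb _ _ _))// ler_piMl.
have cvgx z : cvg (coef n x z @[n --> \oo]).
  apply: cauchy_cvg; apply: cauchy_exP => eps eps0.
  have e20 : 0 < eps / 2 by rewrite divr_gt0.
  have [n nP] := proj_approx z e20.
  exists (coef n x z); exists n => // m /= nm.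
  rewrite /ball/= distrC -(bb_coef_proj bb x z nm).
  rewrite -(scalar_funB (bb_coef_scalar bb m x)) (le_lt_trans (cx _ _))//.
  by rewrite (le_lt_trans nP)// ltr_pdivrMr// ltr_pMr// ltr1n.
pose s z := lim (coef n x z @[n --> \oo]).
have sP : dual_ball X s.
  apply/dual_ballP; split=> [a y z|z].
    apply/cvg_lim; first exact: Rhausdorff.
    under eq_cvg do rewrite (bb_coef_scalar bb).
    by apply: cvgD; [apply: cvgMl_tmp; exact: cvgx|exact: cvgx].
  apply: (@cvgr_to_le _ (nbhs \oo) _ R (fun n => `|coef n x z|)).
    by apply: cvg_norm; exact: cvgx.
  by apply: nearW => n; exact: cx.
exists (SigSub (mem_set sP)); apply/funext => j.
apply/cvg_lim; first exact: Rhausdorff.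
apply: cvg_near_cst; exists j.+1 => // n /= jn.
by rewrite (bb_coef_e bb)// (leq_trans jn)// (leq_offset (bb_oS bb)).
Qed.
End functionals.

Arguments coords {R X} e s j.
Arguments coords_cvg {R X e e' o} _ s z.

(** * The unit vectors of [c0], with blocks of length one *)

Section c0_basis.
Context {R : realType}.

Lemma c0_unit_subproof j : (fun i => (i == j)%:R) \in @c0_pred R.
Proof.
apply/asboolP; apply: cvg_near_cst; exists j.+1 => // i /= ji.
by rewrite gtn_eqF.
Qed.

Definition c0_unit j : c0 R := C0 (c0_unit_subproof j).

Lemma c0_coord_scalar i : scalar (fun u : c0 R => u i).
Proof. by []. Qed.

Lemma c0_sumE (c : nat -> R) n i :
  (\sum_(0 <= j < n) c j *: c0_unit j) i = if (i < n)%N then c i else 0.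
Proof.
rewrite (scalar_fun_sum (c0_coord_scalar i)).
under eq_bigr do rewrite (scalar_funZ (c0_coord_scalar i)) /=.
case: ifPn => [jn|jn].
  rewrite (bigD1_seq i) ?mem_index_iota ?iota_uniq//= eqxx mulr1 big1 ?addr0//.
  by move=> j /negbTE ij; rewrite eq_sym ij mulr0.
rewrite big_nat big1// => j /andP[_ jn'].
by rewrite (_ : i == j = false) ?mulr0//; apply: contraNF jn => /eqP ->.
Qed.

Lemma c0_block_basis : block_basis c0_unit (fun j u => u j) id.
Proof.
split => //.
- by move=> j; exists 1 => z; rewrite mul1r; exact: le_c0_norm.
- move=> n z; apply: c0_norm_le => i; rewrite c0_sumE.
  by case: ifP => _; [exact: le_c0_norm|rewrite normr0; exact: normr_ge0].
- move=> z; apply/cvgrPdist_le => eps eps0.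
  have /cvgr0Pnorm_le/(_ _ eps0)[m _ zm] := c0_cvg z.
  exists m => // n /= mn; apply: c0_norm_le => i.
  rewrite (scalar_funB (c0_coord_scalar i)) c0_sumE.
  case: ltnP => ni; first by rewrite subrr normr0 ltW.
  by rewrite subr0; apply: zm => /=; exact: leq_trans mn ni.
Qed.

Lemma c0_block_norm_le n (w : nat -> R) :
  @block_norm R (c0 R) (fun j u => u j) id n w <= \sum_(0 <= j < n) `|w j|.
Proof.
apply: block_norm_le => z z1; rewrite (le_trans (ler_norm_sum _ _ _))//.
apply: ler_sum => j _; rewrite normrM ler_piMr//.
exact: le_trans (le_c0_norm z j) z1.
Qed.

(** Testing [s] on the truncated vector of signs, of norm at most 1, gives the l_1 bound. *)
Lemma c0_coords_sum n (s : dual_ball (c0 R)) :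
  \sum_(0 <= j < n) `|coords c0_unit s j| <= 1.
Proof.
pose v := \sum_(0 <= j < n) Num.sg (coords c0_unit s j) *: c0_unit j.
have -> : \sum_(0 <= j < n) `|coords c0_unit s j| = delta v s.
  by rewrite delta_sum; apply: eq_bigr => j _; rewrite deltaZ -normrEsg.
rewrite (le_trans (ler_norm _))// (le_trans (le_delta _ _))//.
apply: c0_norm_le => i; rewrite c0_sumE; case: ifP => _; last by rewrite normr0.
by rewrite normr_sg; case: (_ != 0).
Qed.

End c0_basis.

Lemma lattice_isometric_block_basis (R : realType) (X : completeNormedModType R)
    (e : nat -> X) (e' : nat -> X -> R) (o : nat -> nat) :
  block_basis e e' o -> lattice_isometric (FBLinfty X) (FBLinfty (c0 R)).
Proof.
move=> bb; have bb0 := @c0_block_basis R.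
have phi_le1 (s : dual_ball X) n :
    \sum_(0 <= j < o n) `|phi bb (coords e s) j| <= 1.
  by rewrite phi_sum (le_trans (tail_norm_le bb _ _))// (coords_norm_le1 bb).
have [Phi PhiE] : exists Phi : dual_ball X -> dual_ball (c0 R),
    forall s, coords c0_unit (Phi s) = phi bb (coords e s).
  suff /choice[Phi PhiE] : forall s : dual_ball X, exists t : dual_ball (c0 R),
      coords c0_unit t = phi bb (coords e s) by exists Phi.
  move=> s; apply: (coords_surj bb0) => n.
  (* The l_1 bound is known at block ends; [n <= o n] extends it to every [n]. *)
  rewrite (le_trans (c0_block_norm_le _ _))// (le_trans _ (phi_le1 s n))//.
  by rewrite [leRHS](@big_cat_nat _ _ _ n)//= ?(leq_offset (bb_oS bb))// lerDl
    sumr_ge0.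
have Phi_inj : injective Phi.
  move=> s t st; apply: (coords_inj bb); apply: (phi_inj (bb := bb)).
  by rewrite -!PhiE st.
have Phi_surj t : exists s, Phi s = t.
  have [x xt] := phi_surj bb (coords c0_unit t).
  have [|s sx] := @coords_surj _ _ _ _ _ bb x.
    apply: (phi_block_norm_le1 (bb := bb)) => n; rewrite xt.
    exact: c0_coords_sum.
  by exists s; apply: (coords_inj bb0); rewrite PhiE sx xt.
apply: (@lattice_isometric_dual_ball _ _ _ Phi).
- apply: continuous_to_dual_ball => u.
  (* Truncating [u] changes its value by at most [eps] uniformly on the ball, which leaves finitely
     many coordinates of [phi]. *)
  apply: uniform_approx_continuous => eps eps0.
  have [n un] := proj_approx bb0 u eps0.
  exists (fun s => \sum_(0 <= j < n) phi bb (coords e s) j * u j).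
    apply: linear_combination_continuous => j.
    by apply: (phi_continuous (f := coords e)) => i; exact: delta_continuous.
  move=> s; rewrite -PhiE; exact: le_trans (coords_approx _ _ _) un.
- have [Psi PsiK] := choice Phi_surj; exists Psi => // s.
  by apply: Phi_inj; rewrite PsiK.
- move=> a s t a0 st u.
  have phiE j : coords c0_unit (Phi s) j = a * coords c0_unit (Phi t) j.
    rewrite !PhiE -phiZ//; congr (phi bb _ j); apply/funext => i; exact: st.
  have cs := coords_cvg bb0 (Phi s) u; have ct := coords_cvg bb0 (Phi t) u.
  apply: (cvg_unique (@Rhausdorff R) cs).
  rewrite (_ : (fun n => _) = (fun n => a *
      @bb_coef R (c0 R) (fun j u => u j) id n (coords c0_unit (Phi t)) u)).
    exact: cvgMl_tmp.
  apply/funext => n; rewrite /bb_coef mulr_sumr; apply: eq_bigr => j _.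
  by rewrite phiE mulrA.
Qed.

(** * Block bases from decompositions *)

Definition lcomb (R : realType) (X : lmodType R) d (b : 'I_d -> X)
    (c : 'rV[R]_d) : X :=
  \sum_(i < d) c ord0 i *: b i.

(** * Bases and coordinates in finite dimension *)

Section finite_dimension.
Context {R : realType}.

Lemma lcombD (X : lmodType R) d (b : 'I_d -> X) a c1 c2 :
  lcomb b (a *: c1 + c2) = a *: lcomb b c1 + lcomb b c2.
Proof.
rewrite /lcomb scaler_sumr -big_split; apply: eq_bigr => i _ /=.
by rewrite !mxE scalerDl scalerA.
Qed.

Lemma lcomb_delta (X : lmodType R) d (b : 'I_d -> X) i :
  lcomb b (delta_mx ord0 i) = b i.
Proof.
rewrite /lcomb (bigD1 i)//= mxE !eqxx scale1r big1 ?addr0// => j ji.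
by rewrite mxE (negbTE ji) andbF scale0r.
Qed.

(** A spanning family of least size is free, as a nontrivial relation would make one vector
    redundant. *)
Lemma findim_basis (X : lmodType R) (V : set X) : findim_subspace V ->
  exists d (b : 'I_d -> X), [/\ forall i, V (b i),
    forall v, V v -> exists c, v = lcomb b c
    & forall c, lcomb b c = 0 -> c = 0].
Proof.
move=> [F /finite_seqP[s ->] VE].
pose spanning d := exists b : 'I_d -> X,
  (forall i, V (b i)) /\ forall v, V v -> exists c, v = lcomb b c.
have ex : exists d, `[< spanning d >].
  exists (size s); apply/asboolP; pose b i :=
    nth 0 s (nat_of_ord (i : 'I_(size s))).
  exists b; split=> [i|v].
    rewrite VE; exists 1%N, (fun=> 1), (fun=> b i).
    by rewrite big_ord1 scale1r; split => // _; exact: mem_nth.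
  rewrite VE => -[n [c [u [us ->]]]].
  apply: (big_ind (fun x => exists c, x = lcomb b c)).
  - by exists 0; rewrite -[LHS](scale0r 0) /lcomb big1 ?scale0r// => i _;
    rewrite mxE scale0r.
  - by move=> _ _ [c1 ->] [c2 ->]; exists (1 *: c1 + c2);
    rewrite lcombD scale1r.
  - move=> i _; have is_ : (index (u i) s < size s)%N by rewrite index_mem;
    exact: us.
    exists (c i *: delta_mx ord0 (Ordinal is_) + 0); rewrite lcombD lcomb_delta.
    rewrite /b nth_index; last exact: us.
    by rewrite [lcomb b 0]big1 ?addr0// => j _; rewrite mxE scale0r.
case: (ex_minnP ex) => d /asboolP[b [Vb bspan]] dmin; exists d, b;
  split => // c c0.
apply/rowP => k; rewrite mxE; apply/eqP; apply: contraT => ck.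
case: d b Vb bspan dmin c c0 k ck => [|d] b Vb bspan dmin c c0 k ck;
  first by case: k ck.
suff /asboolP/dmin : spanning d by rewrite ltnn.
exists (fun i => b (lift k i)); split => // v /bspan[c' ->].
(* Adding a multiple of the relation [c] kills the [k]-th coefficient. *)
pose c2 := (- (c' ord0 k / c ord0 k)) *: c + c'.
have -> : lcomb b c' = lcomb b c2 by rewrite lcombD c0 scaler0 add0r.
exists (\row_i c2 ord0 (lift k i)); rewrite /lcomb (bigD1_ord k)//=.
rewrite !mxE mulNr divfK// addNr scale0r add0r.
by apply: eq_bigr => i _; rewrite mxE.
Qed.

(** On the compact unit sphere the norm of the combination has a closed range avoiding 0, hence
    avoiding a ball around 0. *)
Lemma lcomb_lower_bound (X : normedModType R) d (b : 'I_d -> X) :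
  (forall c, lcomb b c = 0 -> c = 0) ->
  exists2 C, 0 < C & forall c, `|c| <= C * `|lcomb b c|.
Proof.
move=> bfree.
pose S := [set c : 'rV[R]_d | `|c| = 1].
have cS : compact S.
  apply: bounded_closed_compact.
    by exists 1; split => // M M1 c /= ->; exact: ltW.
  apply: (@preimage_closed _ _ (fun c : 'rV[R]_d => `|c|) [set 1]);
    last exact: closed_eq.
  by move=> c _; exact: norm_continuous.
pose g (c : 'rV[R]_d) := `|lcomb b c|.
have cl : continuous (lcomb b : 'rV[R]_d -> X).
  move=> c; pose f i (c : 'rV[R]_d) := c ord0 i *: b i.
  apply: (@cvg_sumr R X _ _ (nbhs c) (index_enum _) xpredT f (f ^~ c)) => i _.
  by apply: cvgZr_tmp; exact: coord_continuous.
have cg : continuous g.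
  by move=> c; apply: (@cvg_norm R X _ (nbhs c) _ (lcomb b) (lcomb b c));
    exact: cl.
have cgS : closed (g @` S).
  apply: compact_closed; first exact: Rhausdorff.
  by apply: continuous_compact => //; exact: continuous_subspaceT.
have gS0 : (~` (g @` S)) 0.
  move=> [c c1 /normr0_eq0/bfree c0]; move: c1; rewrite c0 /S /= normr0 => /eqP.
  by rewrite eq_sym oner_eq0.
have /nbhs_ballP[C /= C0 gC] : nbhs 0 (~` (g @` S)).
  by apply: open_nbhs_nbhs; split => //; exact: closed_openC.
exists C^-1; first by rewrite invr_gt0.
move=> c; rewrite ler_pdivlMl//; have [->|c0] := eqVneq c 0.
  by rewrite normr0 mulr0.
have nc : 0 < `|c| by rewrite normr_gt0.
rewrite -ler_pdivlMr// leNgt; apply/negP => lt.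
apply: (gC (g (`|c|^-1 *: c))).
  rewrite /ball/= sub0r normrN normr_id /g -[_ *: c]addr0 lcombD.
  rewrite [lcomb b 0]big1 ?addr0; last by move=> j _; rewrite mxE scale0r.
  by rewrite normrZ normfV normr_id mulrC.
exists (`|c|^-1 *: c) => //; rewrite /S /= normrZ normfV normr_id mulVf//.
by rewrite gt_eqF.
Qed.
End finite_dimension.

Lemma findim_coordinates (R : realType) (X : normedModType R) (V : set X)
    (p : {linear X -> X}) C :
  findim_subspace V -> V <> [set 0] -> range p = V ->
  (forall x, p (p x) = p x) -> (forall x, `|p x| <= C * `|x|) ->
  exists d (b : nat -> X) (b' : nat -> X -> R),
    [/\ (0 < d)%N, (forall j, scalar (b' j)) /\
          (forall j, exists C', forall z, `|b' j z| <= C' * `|z|),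
        forall i j, (i < d)%N -> (j < d)%N -> b' i (b j) = (i == j)%:R,
        forall j z, b' j (p z) = b' j z /\ p (b j) = b j
      & forall z, p z = \sum_(0 <= j < d) b' j z *: b j].
Proof.
move=> /findim_basis[d [b [Vb bspan bfree]]] V0 pV pp pC.
have pb i : p (b i) = b i by have := Vb i; rewrite -pV => -[y _ <-].
have /choice[c cP] : forall z, exists c, p z = lcomb b c.
  by move=> z; apply: bspan; rewrite -pV; exists z.
have lcomb_inj c1 c2 : lcomb b c1 = lcomb b c2 -> c1 = c2.
  move=> c12; apply/eqP; rewrite -subr_eq0; apply/eqP/bfree.
  by rewrite addrC -scaleN1r lcombD c12 scaleN1r addNr.
have cL a y z : c (a *: y + z) = a *: c y + c z.
  by apply: lcomb_inj; rewrite lcombD -!cP linearP.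
have cp z : c (p z) = c z by apply: lcomb_inj; rewrite -!cP pp.
have cb i : c (b i) = delta_mx ord0 i.
  by apply: lcomb_inj; rewrite -cP pb lcomb_delta.
have [M M0 Mc] := lcomb_lower_bound bfree.
case: d b Vb bspan bfree pb c cP lcomb_inj cL cp cb Mc =>
  [|d] b Vb bspan bfree pb c cP _ cL cp cb Mc.
  exfalso; apply: V0; apply/seteqP; split=> [v /bspan[c' ->]|_ ->] /=.
    by rewrite /lcomb big_ord0.
  by rewrite -pV; exists 0 => //; rewrite linear0.
(* [inord] gives default values out of range; biorthogonality is claimed only in range. *)
exists d.+1, (fun j => b (inord j)), (fun j z => c z ord0 (inord j));
  split => //.
- split=> [j a y z|j]; first by rewrite cL !mxE.
  exists (M * C) => z; apply: (@le_trans _ _ `|c z|).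
    rewrite [leRHS]/Num.norm /= mx_normrE.
    by apply/bigmax_geP; right; exists (ord0, inord j).
  by rewrite (le_trans (Mc _))// -mulrA ler_pM2l// -cP.
- move=> i j id jd; rewrite cb mxE eqxx/=; congr (_%:R).
  by rewrite -(inj_eq val_inj)/= !inordK.
- by move=> j z; rewrite cp pb.
- by move=> z; rewrite cP /lcomb big_mkord; apply: eq_bigr => i _;
  rewrite inord_val.
Qed.

(** Bases of the successive summands are concatenated, with the cumulative dimensions as offsets. *)
Lemma monotone_fdd_block_basis (R : realType) (X : normedModType R)
    (Z : nat -> set X) : monotone_fdd Z ->
  exists (e : nat -> X) (e' : nat -> X -> R) (o : nat -> nat),
    block_basis e e' o.
Proof.
move=> [P [[Zfd [_ [Pproj [Portho [_ Pcvg]]]]] Pmono]].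
have psumS n x : psum P n.+1 x = psum P n x + P n.+1 x.
  by rewrite /psum big_ord_recr.
have psum_le n x : `|psum P n x| <= `|x|.
  apply: opnorm_le1; last exact: Pmono.
  by move=> a y; rewrite /psum scaler_sumr; apply: eq_bigr => i _;
    rewrite linearZ.
(* Each projection after the first is a difference of two contractive partial sums. *)
have P_le i x : `|P i x| <= 2 * `|x|.
  case: i => [|i].
    have := psum_le 0%N x; rewrite /psum big_ord1 => /le_trans; apply.
    by rewrite ler_peMl// ler1n.
  have -> : P i.+1 x = psum P i.+1 x - psum P i x by rewrite psumS addrC addKr.
  by rewrite (le_trans (ler_normB _ _))// mulr_natl mulr2n lerD.
have H i := let: conj fdZ Z0 := Zfd i in let: conj rP PP := Pproj i in
  findim_coordinates fdZ Z0 rP PP (P_le i).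
have [d /choice[b /choice[b' bP]]] := choice H.
pose o := fix o n := if n is m.+1 then (o m + d m)%N else 0%N.
have oS n : (o n < o n.+1)%N.
  by have [d0 _ _ _ _] := bP n; rewrite /= -addn1 leq_add2l.
have o0 : o 0%N = 0%N by [].
pose bi := block_index oS.
have biP j : (o (bi j) <= j < o (bi j).+1)%N := block_indexP o0 oS j.
have off j : (j - o (bi j) < d (bi j))%N.
  by have := biP j; rewrite /=; lia.
exists (fun j => b (bi j) (j - o (bi j))%N),
  (fun j => b' (bi j) (j - o (bi j))%N), o.
have projE n z : \sum_(0 <= j < o n) b' (bi j) (j - o (bi j))%N z *:
    b (bi j) (j - o (bi j))%N = \sum_(i < n) P i z.
  elim: n => [|n ih]; first by rewrite big_geq// big_ord0.
  rewrite (@big_cat_nat _ _ _ (o n))//=; last exact: leq_addr.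
  rewrite ih big_ord_recr/=; congr (_ + _).
  have [_ _ _ _ ->] := bP n.
  rewrite -{1}(add0n (o n)) (addnC (o n) (d n)) big_addn addnK;
    apply: eq_big_nat => k /andP[_ kd].
  have -> : bi (k + o n)%N = n by apply: (block_indexE o0); rewrite /=; lia.
  by rewrite addnK.
split => //.
- by move=> j; have [_ [h _] _ _ _] := bP (bi j); exact: h.
- by move=> j; have [_ [_ h] _ _ _] := bP (bi j); exact: h.
- move=> i j; have [ij|ij] := eqVneq (bi i) (bi j).
    have [_ _ h _ _] := bP (bi j); rewrite ij h//; last by rewrite -ij.
    congr (_%:R); have := biP i; have := biP j; rewrite ij.
    move: (o _) => m; case: (eqVneq i j) => [-> //|]; first by rewrite eqxx.
    by move=> /eqP ij' /andP[h1 _] /andP[h2 _]; apply/eqP; lia.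
  (* Across distinct blocks, the functional factors through [P (bi i)] and the vector is fixed by
     [P (bi j)], so orthogonality gives 0. *)
  have [_ [sc _] _ hi _] := bP (bi i); have [_ _ _ hj _] := bP (bi j).
  rewrite -(hi _ _).1 -(hj _ 0).2 Portho; last exact/eqP.
  rewrite (scalar_fun0 (sc _)); case: (eqVneq i j) ij => // ->.
  by rewrite eqxx.
(* [psum P n] has [n.+1] terms, so zero blocks are treated apart. *)
- move=> [|n] z; rewrite projE; first by rewrite big_ord0 normr0.
  exact: psum_le.
- move=> z; apply/cvgrPdist_le => eps eps0.
  have /cvgrPdist_le/(_ _ eps0)[m _ h] := Pcvg z.
  by exists m.+1 => // -[//|n] mn; rewrite projE; apply: h; exact: mn.
Qed.

Theorem theorem10p24 (R : realType) (X : completeNormedModType R)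
    (Z : nat -> set X) (hZ : monotone_fdd Z) :
  lattice_isometric (FBLinfty X) (FBLinfty (c0 R)).
Proof.
have [? [? [? bb]]] := monotone_fdd_block_basis hZ.
exact: lattice_isometric_block_basis bb.
Qed.
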